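(* Suppose $(\mathbb{X},d,\nu)$ satisfies Assumption (A). Let $\Lambda\subseteq\mathbb{X}$ be bounded and measurable, $\lambda\in\mathbb{C}$, and let $\Phi$ be a collection of symmetric repulsive potentials that is closed under modification and $\delta$-zero-free on $\Lambda$ at activity $\lambda$ for some $\delta>0$. Then for every $\phi\in\Phi$ and every $y\in\mathbb{X}$, the modified point densities (on $\Lambda$, at activity $\lambda$) satisfy $$\kappa(y)=\lambda\exp\left(-\sum_{k\in\mathbb{N}}\frac{1}{k!}\int_{\Lambda^k}\left(1-e^{-\phi(y,\mathbf{w})}\right)e^{-H(\mathbf{w}\mid y_{\prec\mathbf{w}})}\,\kappa(\mathbf{w}\mid y_{\prec\mathbf{w}})\,\nu^k(d\mathbf{w})\right).$$
   Context: $(\mathbb{X},d)$ is a complete separable metric space with a locally finite Borel measure $\nu$. Assumption (A): for every $x\in\mathbb{X}$, the push-forward of $\nu$ under $y\mapsto d(x,y)$ is absolutely continuous with respect to Lebesgue measure on $\mathbb{R}$. A potential $\phi=(\phi_k)_{k\in\mathbb{N}}$ is a family of measurable $\phi_k:\mathbb{X}^k\to\mathbb{R}\cup\{\infty\}$, written $\phi(\mathbf{x})=\phi_k(\mathbf{x})$; symmetric: invariant under coordinate permutations; repulsive: $\phi_k\ge0$. For $\mathbf{x}\in\mathbb{X}^k$, $S\subseteq[k]$, $\mathbf{x}_S=(x_i)_{i\in S}$; $H(\mathbf{x})=\sum_{\emptyset\ne S\subseteq[k]}\phi(\mathbf{x}_S)$; $Z_{\Lambda,\phi}(\lambda)=\sum_{k\ge0}\frac{\lambda^k}{k!}\int_{\Lambda^k}e^{-H(\mathbf{x})}\nu^k(d\mathbf{x})$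 with $e^{-\infty}=0$. $\phi(y,\mathbf{w})$ is $\phi_{k+1}$ at the concatenated tuple. Pinning: for $\mathbf{x}\in\mathbb{X}^k$, $\phi(\cdot\mid\mathbf{x})$ is the potential $\phi(\mathbf{y}\mid\mathbf{x})=\sum_{S\subseteq[k]}\phi(\mathbf{y},\mathbf{x}_S)$ ($S=\emptyset$ gives $\phi(\mathbf{y})$); $Z_{\Lambda,\phi}(\lambda\mid\mathbf{x})$ is its partition function. Modified $k$-point density: if $Z_{\Lambda,\phi}(\lambda)\neq0$, $\kappa(\mathbf{x})=\kappa_{\Lambda,\phi,\lambda}(\mathbf{x})=\lambda^kZ_{\Lambda,\phi}(\lambda\mid\mathbf{x})/Z_{\Lambda,\phi}(\lambda)$ for $\mathbf{x}\in\mathbb{X}^k$. Fix $z\in\mathbb{X}$ and set $D(\mathbf{x})=\sum_j d(z,x_j)$. Write $\mathbf{x}\prec t$ if $D(\mathbf{x})<t$ ($t\in[0,\infty]$) and $\mathbf{x}\prec\mathbf{w}$ if $D(\mathbf{x})<D(\mathbf{w})$. Partial pinning: for $y\in\mathbb{X}$, $\phi(\mathbf{x}\mid y_{\prec t})=\phi(\mathbf{x}\mid y)$ if $\mathbf{x}\prec t$ and $=\phi(\mathbf{x})$ otherwise; $\phi(\cdot\mid y_{\prec\mathbf{w}}):=\phi(\cdot\mid y_{\prec D(\mathbf{w})})$. $H(\cdot\mid y_{\prec\mathbf{w}})$ and $\kappa(\cdot\mid y_{\prec\mathbf{w}})$ are the Hamiltonian and modified point density (on $\Lambda$ at $\lambda$)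 for the potential $\phi(\cdot\mid y_{\prec\mathbf{w}})$; thus $\kappa(\mathbf{w}\mid y_{\prec\mathbf{w}})=\lambda^kZ_{\Lambda,\phi(\cdot\mid y_{\prec\mathbf{w}})}(\lambda\mid\mathbf{w})/Z_{\Lambda,\phi(\cdot\mid y_{\prec\mathbf{w}})}(\lambda)$ for $\mathbf{w}\in\mathbb{X}^k$. $\Phi$ is $\delta$-zero-free on $\Lambda$ at $\lambda$ if $|Z_{\Lambda,\phi}(\lambda)|\ge\delta$ for all $\phi\in\Phi$. $\Phi$ is closed under modification if (1) for all $\phi\in\Phi$, $y\in\mathbb{X}$, $t\in[0,\infty]$, $\phi(\cdot\mid y_{\prec t})\in\Phi$, and (2) for all $\phi\in\Phi$ and measurable $\Delta\subseteq\mathbb{X}$, the potential $\psi$ with $\psi_k=\phi_k$ for $k\ge2$ and $\psi_1=\infty$ on $\Delta$, $\psi_1=\phi_1$ off $\Delta$, lies in $\Phi$. *)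

(* Defs.v *)
From HB Require Import structures.
From mathcomp Require Import all_boot all_order all_algebra.
From mathcomp Require Import all_classical all_reals all_analysis.
From mathcomp Require Import fingroup perm.
From mathcomp Require Import measurable_realfun complex.
Set Implicit Arguments.
Unset Strict Implicit.
Unset Printing Implicit Defensive.
Import Order.TTheory GRing.Theory Num.Theory.
Import numFieldNormedType.Exports.
Local Open Scope classical_set_scope.
Local Open Scope ring_scope.

Section GasDefs.
Context (R : realType) (d : measure_display) (X : measurableType d).

Definition is_metric (dist : X -> X -> R) : Prop :=
  [/\ (forall x y, 0 <= dist x y),
      (forall x y, dist x y = 0 <-> x = y),
      (forall x y, dist x y = dist y x) &
      (forall x y w, dist x w <= dist x y + dist y w)].

Definition metric_complete (dist : X -> X -> R) : Prop :=
  forall u : nat -> X,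
    (forall e : R, 0 < e -> exists N, forall m n, (N <= m)%N -> (N <= n)%N ->
        dist (u m) (u n) < e) ->
    exists l, forall e : R, 0 < e -> exists N, forall n, (N <= n)%N -> dist (u n) l < e.

Definition metric_separable (dist : X -> X -> R) : Prop :=
  exists C : set X, countable C /\
    forall x (e : R), 0 < e -> exists2 c, C c & dist x c < e.

Definition metric_open (dist : X -> X -> R) (O : set X) : Prop :=
  forall x, O x -> exists2 e : R, 0 < e & forall y, dist x y < e -> O y.

Definition metric_bounded (dist : X -> X -> R) (B : set X) : Prop :=
  exists x (r : R), forall y, B y -> dist x y <= r.

Definition borel_for (dist : X -> X -> R) : Prop :=
  forall A : set X, measurable A <-> <<s [set O | metric_open dist O] >> A.

Definition locally_finite (dist : X -> X -> R) (nu : set X -> \bar R) : Prop :=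
  forall B, measurable B -> metric_bounded dist B -> (nu B < +oo)%E.

Definition assumptionA (dist : X -> X -> R) (nu : set X -> \bar R) : Prop :=
  forall (x : X) (A : set R), measurable A ->
    (@lebesgue_measure R A = 0)%E -> nu (dist x @^-1` A) = 0%E.

Fixpoint prodm (nu : set X -> \bar R) (k : nat) : set (k.-tuple X) -> \bar R :=
  match k return set (k.-tuple X) -> \bar R with
  | 0 => @dirac _ (0.-tuple X) [tuple] R
  | k'.+1 => fun A =>
      (nu \x @prodm nu k')%E
        ((fun p : X * k'.-tuple X => [tuple of p.1 :: tval p.2]) @^-1` A)
  end.
Arguments prodm nu k : clear implicits.

Definition powset (Lam : set X) (k : nat) : set (k.-tuple X) :=
  [set w | forall i, Lam (tnth w i)].
Arguments powset Lam k : clear implicits.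

Definition cint (nu : set X -> \bar R) (Lam : set X) (k : nat)
    (f : k.-tuple X -> R[i]) : R[i] :=
  Complex (fine (\int[prodm nu k]_(w in powset Lam k) (complex.Re (f w))%:E)%E)
          (fine (\int[prodm nu k]_(w in powset Lam k) (complex.Im (f w))%:E)%E).

Definition cintegrable (nu : set X -> \bar R) (Lam : set X) (k : nat)
    (f : k.-tuple X -> R[i]) : Prop :=
  (prodm nu k).-integrable (powset Lam k) (fun w => (complex.Re (f w))%:E) /\
  (prodm nu k).-integrable (powset Lam k) (fun w => (complex.Im (f w))%:E).

Definition ccvg_series (u : nat -> R[i]) : Prop :=
  cvgn (series (fun n => complex.Re (u n))) /\ cvgn (series (fun n => complex.Im (u n))).

Definition csum (u : nat -> R[i]) : R[i] :=
  Complex (limn (series (fun n => complex.Re (u n)))) (limn (series (fun n => complex.Im (u n)))).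

Definition cexp (w : R[i]) : R[i] :=
  Complex (expR (complex.Re w) * cos (complex.Im w)) (expR (complex.Re w) * sin (complex.Im w)).

(** A potential phi = (phi_k)_{k >= 1}: phi s is phi_{size s}(s); the value on the
    empty sequence is irrelevant (never used). *)
Definition potential := seq X -> \bar R.

Definition pot_measurable (phi : potential) : Prop :=
  forall k, measurable_fun [set: k.-tuple X] (fun t : k.-tuple X => (phi (tval t) : \bar R)).

Definition pot_symmetric (phi : potential) : Prop :=
  forall k (t : k.-tuple X) (s : 'S_k),
    phi [seq tnth t (s i) | i <- enum 'I_k] = phi (tval t).

Definition pot_repulsive (phi : potential) : Prop :=
  forall s : seq X, s <> [::] -> (0 <= phi s)%E.

Definition subseqS (x : seq X) (S : {set 'I_(size x)}) : seq X :=
  [seq tnth (in_tuple x) i | i <- enum S].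

Definition hamiltonian (phi : potential) (x : seq X) : \bar R :=
  (\sum_(S : {set 'I_(size x)} | (0 < #|S|)%N) phi (subseqS S))%E.

Definition Zk (nu : set X -> \bar R) (Lam : set X) (phi : potential) (k : nat) : R :=
  fine (\int[prodm nu k]_(w in powset Lam k) expeR (- hamiltonian phi (tval w)))%E.

Definition partition (nu : set X -> \bar R) (Lam : set X) (phi : potential)
    (lam : R[i]) : R[i] :=
  csum (fun k => lam ^+ k / (k`!)%:R * (Zk nu Lam phi k)%:C%C).

Definition pin (phi : potential) (x : seq X) : potential :=
  fun s => (\sum_(S : {set 'I_(size x)}) phi (s ++ subseqS S))%E.

Definition kappa (nu : set X -> \bar R) (Lam : set X) (phi : potential)
    (lam : R[i]) (x : seq X) : R[i] :=
  lam ^+ size x * partition nu Lam (pin phi x) lam / partition nu Lam phi lam.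

Definition Dz (dist : X -> X -> R) (z : X) (x : seq X) : R :=
  \sum_(xj <- x) dist z xj.

Definition ppin (dist : X -> X -> R) (z : X) (phi : potential) (y : X)
    (t : \bar R) : potential :=
  fun s => if ((Dz dist z s)%:E < t)%E then pin phi [:: y] s else phi s.

Definition ppinw (dist : X -> X -> R) (z : X) (phi : potential) (y : X)
    (w : seq X) : potential :=
  ppin dist z phi y (Dz dist z w)%:E.

Definition modify (phi : potential) (Delta : set X) : potential :=
  fun s => match s with
           | [:: x] => if `[< Delta x >] then +oo%E else phi s
           | _ => phi s
           end.

Definition closed_under_modification (dist : X -> X -> R) (z : X)
    (Phi : set potential) : Prop :=
  (forall phi y (t : \bar R), Phi phi -> (0 <= t)%E -> Phi (ppin dist z phi y t)) /\
  (forall phi (Delta : set X), Phi phi -> measurable Delta -> Phi (modify phi Delta)).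

Definition zero_free (nu : set X -> \bar R) (Lam : set X) (lam : R[i])
    (delta : R) (Phi : set potential) : Prop :=
  forall phi, Phi phi -> (delta%:C)%C <= `|partition nu Lam phi lam|.

Definition main_integrand (dist : X -> X -> R) (z : X) (nu : set X -> \bar R)
    (Lam : set X) (phi : potential) (lam : R[i]) (y : X) (k : nat)
    (w : k.-tuple X) : R[i] :=
  ((1 - fine (expeR (- phi (y :: tval w))))
   * fine (expeR (- hamiltonian (ppinw dist z phi y (tval w)) (tval w))))%:C%C
  * kappa nu Lam (ppinw dist z phi y (tval w)) lam (tval w).

End GasDefs.

(* Main.v *)
Require Import Defs.
From HB Require Import structures.
From mathcomp Require Import all_boot all_order all_algebra.
From mathcomp Require Import all_classical all_reals all_analysis.
From mathcomp Require Import fingroup perm.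
From mathcomp Require Import measurable_realfun complex.
From mathcomp Require Import ring lra.
Set Implicit Arguments.
Unset Strict Implicit.
Unset Printing Implicit Defensive.
Import Order.TTheory GRing.Theory Num.Theory.
Import numFieldNormedType.Exports.
Local Open Scope classical_set_scope.
Local Open Scope ring_scope.

(** Adding [y] to the pinned points gradually, along the order given by
    [Dz dist z], interpolates between [phi] and [pin phi [:: y]].  Write [f t]
    for the partition function of [ppin dist z phi y t].  For almost every
    configuration the values of [Dz] on its subconfigurations are pairwise
    distinct (this is where Assumption (A) enters), so the Boltzmann weight
    changes by one factor at a time as [t] grows; summing these changes and
    splitting the configuration [x] into the subconfiguration [w] responsible
    for the change and the rest gives
      [f s - f t = sum_k 1/k! int 1(s <= Dz w < t) g_k(w) f(Dz w)],
    where [g_k] is [main_integrand].  With [M s t] the same sum without the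
    factor [f(Dz w)], zero-freeness shows that [h t = f t * exp (M 0 t)]
    satisfies [|h t - h s| <= C * rho([s, t))^2] for a finite atomless measure
    [rho] on the line.  Halving [rho]-mass repeatedly forces [h] to be
    constant, and [h 0 = h +oo] is the theorem. *)

(** * Subconfigurations *)

(** For infinitesimally close thresholds the increment identity reads df = - f dM, whose solution f
    = f(0) exp(-M) is the theorem. Two things stand in the way of solving it directly. A logarithm
    of the complex function [f] would need a choice of branch; the product [h] avoids it. And [f] is
    not known to be differentiable in t: only its increments are bounded, by the mass of [rho], so
    [rho] replaces the time variable. The one-step error is quadratic for two reasons: freezing f(Dz
    w) at f s costs at most rho([s, t)) inside an integral already of that order, and exp m - 1 - m
    is quadratic in m = M s t. The integrand of M contains 1/f(Dz w), the denominator of kappa(w |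
    y_<w); the lower bound delta on |f|, uniform over all thresholds, keeps it bounded. Repulsion
    puts every Boltzmann weight in [0, 1], so all series are dominated by the exponential series in
    [nc lam] times nu(Lam), and the weights of [rho] are read off from this majorant. *)

Section Subsequences.
Variable T : Type.

(** Subsequences are listed by position, so repeated points count separately, as they do for the
    index sets in [hamiltonian] and [pin]. The list form opens later products and integrals to
    induction on the sequence. *)
Fixpoint subs (s : seq T) : seq (seq T) :=
  if s is x :: s' then map (cons x) (subs s') ++ subs s' else [:: [::]].

(** Each subsequence is paired with its complement, in the order of [subs]; this keeps the remaining
    points available for integration. *)
Fixpoint splits (s : seq T) : seq (seq T * seq T) :=
  if s is x :: s' then
    [seq (x :: p.1, p.2) | p <- splits s'] ++ [seq (p.1, x :: p.2) | p <- splits s']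
  else [:: ([::], [::])].

Lemma subs_splits s : subs s = [seq p.1 | p <- splits s].
Proof. by elim: s => //= x s ->; rewrite map_cat -!map_comp. Qed.

Section Big.
Variables (A : Type) (idx : A) (op : Monoid.com_law idx).

Lemma big_subs_cons x s (F : seq T -> A) :
  \big[op/idx]_(t <- subs (x :: s)) F t =
  op (\big[op/idx]_(t <- subs s) F (x :: t)) (\big[op/idx]_(t <- subs s) F t).
Proof. by rewrite /= big_cat big_map. Qed.

Lemma big_splits_cons x s (F : seq T -> seq T -> A) :
  \big[op/idx]_(p <- splits (x :: s)) F p.1 p.2 =
  op (\big[op/idx]_(p <- splits s) F (x :: p.1) p.2)
     (\big[op/idx]_(p <- splits s) F p.1 (x :: p.2)).
Proof. by rewrite /= big_cat !big_map. Qed.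

Lemma big_subs_cat u v (F : seq T -> A) :
  \big[op/idx]_(t <- subs (u ++ v)) F t =
  \big[op/idx]_(a <- subs u) \big[op/idx]_(b <- subs v) F (a ++ b).
Proof.
elim: u F => [|x u IH] F; first by rewrite big_seq1.
by rewrite cat_cons !big_subs_cons !IH.
Qed.

Lemma big_tuple_mask n x (F : seq T -> A) : size x = n ->
  \big[op/idx]_(m : n.-tuple bool) F (mask m x) = \big[op/idx]_(t <- subs x) F t.
Proof.
elim: n x F => [|n IH] [|a x] F //=.
  move=> _; rewrite big_seq1 (bigD1 [tuple])//= big1 ?Monoid.mulm1// => m.
  by move=> /negP[]; apply/eqP/tuple0.
move=> [xn]; rewrite big_cat big_map -!IH//=.
pose h (p : bool * n.-tuple bool) : n.+1.-tuple bool := [tuple of p.1 :: p.2].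
rewrite (reindex h) /=; last first.
  exists (fun t : n.+1.-tuple bool => (thead t, [tuple of behead t])).
    by move=> [b m] _; congr pair; apply/val_inj.
  by move=> t _; rewrite /h/= [RHS]tuple_eta.
rewrite -(pair_bigA _ (fun b m => F (mask (h (b, m)) (a :: x)))) /= big_bool/=.
by [].
Qed.

End Big.
End Subsequences.

Section SubsequencesEq.
Variable T : eqType.

Definition perm_invariant (A : Type) (F : seq T -> A) :=
  forall s t, perm_eq s t -> F s = F t.

Lemma splits_perm (s : seq T) p : p \in splits s -> perm_eq s (p.1 ++ p.2).
Proof.
elim: s p => [|x s IH] p /=; first by rewrite inE => /eqP ->.
rewrite mem_cat => /orP[] /mapP[q /IH qs ->] /=; first by rewrite perm_cons.
by rewrite perm_sym perm_catC /= perm_cons perm_catC perm_sym.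
Qed.

(** Induction on [x]: its head is located in [x'] and pulled to the front there. The subsequences
    containing it are only permuted, which [F] does not notice. *)
Lemma perm_big_subs (A : Type) (idx : A) (op : Monoid.com_law idx)
    (F : seq T -> A) x x' : perm_invariant F -> perm_eq x x' ->
  \big[op/idx]_(s <- subs x) F s = \big[op/idx]_(s <- subs x') F s.
Proof.
elim: x x' F => [|a x IH] x' F pF xx'.
  by move: xx'; rewrite perm_sym => /perm_nilP ->.
have : a \in x' by rewrite -(perm_mem xx') mem_head.
move=> ax'; case/splitPr: ax' xx' => u v xx'.
have xuv : perm_eq x (u ++ v).
  by rewrite -(perm_cons a) (perm_trans xx')// -cat1s perm_catCA.
have pFa : perm_invariant (fun s => F (a :: s)).
  by move=> s t st; apply: pF; rewrite perm_cons.
rewrite big_subs_cons (IH (u ++ v))// (IH (u ++ v) F)// !big_subs_cat.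
rewrite -big_split /=; apply: eq_bigr => s _.
rewrite big_subs_cons; congr (op _ _); apply: eq_bigr => t _.
by apply: pF; rewrite perm_sym -cat1s perm_catCA.
Qed.

End SubsequencesEq.

(** * Telescoping a product along the order given by [D] *)

Section Telescope.
Variables (R : realType) (I : eqType) (D a : I -> R).

(** After sorting by [D], strictly since the values are distinct, the head [x] has nothing before it
    and precedes all others. Induction then uses 1 - a x * P = (1 - a x) + a x * (1 - P). *)
Let tele_full (l : seq I) : uniq (map D l) ->
  1 - \prod_(s <- l) a s =
  \sum_(s <- l) (1 - a s) * \prod_(s' <- l | D s' < D s) a s'.
Proof.
pose r s s' := D s <= D s'; pose l' := sort r l => ul.
have pl : perm_eq l l' by rewrite perm_sym perm_sort.
rewrite (perm_big l')//= [in RHS](perm_big l')//=.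
under [in RHS]eq_bigr do rewrite (perm_big l')//=.
have : sorted <%R (map D l').
  rewrite lt_sorted_uniq_le; apply/andP; split.
    by rewrite -(perm_uniq (perm_map D pl)).
  rewrite sorted_map; apply: sort_sorted => s s'; exact: le_total.
elim: l' {pl} => [|x l' IH]; first by rewrite !big_nil subrr.
rewrite /= (path_sortedE lt_trans) => /andP[/allP xl' sl'].
have xl s : s \in l' -> D x < D s by move=> sl; apply/xl'/map_f.
rewrite !big_cons ltxx [in RHS](big_seq_cond (fun s' => D s' < D x)).
rewrite [X in _ = _ * X + _](_ : _ = 1); last first.
  by apply: big1 => s /andP[/xl] /lt_gtF ->.
rewrite [X in _ = _ + X](_ : _ = a x * (1 - \prod_(s <- l') a s)); first by ring.
rewrite IH// mulr_sumr big_seq [RHS]big_seq; apply: eq_bigr => s /xl xs.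
by rewrite big_cons xs; ring.
Qed.

(** No threshold remains in the inner product, since D s' < D s < t makes it automatic. Hence the
    summand of a given [s] is the same for all thresholds above D s, and two such expansions
    subtract termwise. *)
Lemma telescope_prod (l : seq I) (t : \bar R) : uniq (map D l) ->
  1 - \prod_(s <- l | ((D s)%:E < t)%E) a s =
  \sum_(s <- l | ((D s)%:E < t)%E) (1 - a s) * \prod_(s' <- l | D s' < D s) a s'.
Proof.
move=> ul; pose p s := ((D s)%:E < t)%E.
rewrite -[in LHS](big_filter _ p) -[in RHS](big_filter _ p).
rewrite tele_full; last first.
  by apply: subseq_uniq ul; apply/map_subseq/filter_subseq.
rewrite !big_seq; apply: eq_bigr => s; rewrite mem_filter => /andP[ps _].
congr (_ * _); rewrite big_filter_cond; apply: eq_bigl => s'.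
have [lt|//] := boolP (D s' < D s); rewrite ?andbF ?andbT ?/p//.
by apply: lt_trans ps; rewrite lte_fin.
Qed.

End Telescope.

(** * Boltzmann weights *)

Section Boltzmann.
Context (R : realType) (d : measure_display) (X : measurableType d).
Implicit Types (psi : @potential R d X) (x s w v : seq X).

Lemma subseqSE x (S : {set 'I_(size x)}) :
  subseqS S = mask [tuple i \in S | i < size x] x.
Proof.
rewrite /subseqS {1}/enum_mem filter_mask -enumT map_mask map_tnth_enum.
by congr (mask _ _); apply: eq_map => i.
Qed.

(** An index set is encoded by its membership mask; this turns the sums over sets in the definitions
    into recursion on lists. *)
Lemma big_subseqS (A : Type) (idx : A) (op : Monoid.com_law idx) x (F : seq X -> A) :
  \big[op/idx]_(S : {set 'I_(size x)}) F (subseqS S) =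
  \big[op/idx]_(s <- subs x) F s.
Proof.
rewrite -(big_tuple_mask op F (erefl (size x))).
pose h (m : (size x).-tuple bool) := [set i | tnth m i]%SET.
rewrite (reindex h) /=; last first.
  exists (fun S : {set 'I_(size x)} => [tuple i \in S | i < size x]) => [m _|S _].
    by apply: eq_from_tnth => i; rewrite tnth_mktuple inE.
  by apply/setP => i; rewrite inE tnth_mktuple.
apply: eq_bigr => m _; rewrite subseqSE; congr (F (mask _ _)).
by congr tval; apply: eq_from_tnth => i; rewrite tnth_mktuple inE.
Qed.

Lemma expeRN_fin (e : \bar R) : (0 <= e)%E -> (expeR (- e) \is a fin_num)%E.
Proof. by case: e. Qed.

Lemma expeRN_itv (e : \bar R) : (0 <= e)%E -> 0 <= fine (expeR (- e)) <= 1.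
Proof.
case: e => [r| |] //= r0; last by rewrite lexx ler01.
by rewrite expR_ge0 -[leRHS]expR0 ler_expR oppr_le0.
Qed.

Lemma expeRN_sum (I : Type) (l : seq I) (F : I -> \bar R) :
  (forall i, 0 <= F i)%E ->
  expeR (- \sum_(i <- l) F i)%E = (\prod_(i <- l) fine (expeR (- F i)))%:E.
Proof.
move=> F0; elim: l => [|i l IH]; first by rewrite !big_nil oppe0 /= expR0.
rewrite !big_cons oppeD; last first.
  by rewrite ge0_adde_def// inE// sume_ge0.
by rewrite expeRD IH EFinM fineK// expeRN_fin.
Qed.

(** The value 1 on the empty sequence accounts for [hamiltonian] skipping the empty index set.
    Infinite interactions become the real factor 0. *)
Definition wt psi s : R := if nilp s then 1 else fine (expeR (- psi s)).

Definition boltz psi x : R := \prod_(s <- subs x) wt psi s.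

Lemma wt_itv psi s : pot_repulsive psi -> 0 <= wt psi s <= 1.
Proof.
rewrite /wt => rp; case: nilP => [_|s0]; first by rewrite ler01 lexx.
exact/expeRN_itv/rp.
Qed.

Lemma prod_itv01 (I : Type) (l : seq I) (F : I -> R) :
  (forall i, 0 <= F i <= 1) -> 0 <= \prod_(i <- l) F i <= 1.
Proof.
move=> F01; rewrite prodr_ge0 ?prodr_ile1//= => i _; by have /andP[] := F01 i.
Qed.

Lemma boltz_itv psi x : pot_repulsive psi -> 0 <= boltz psi x <= 1.
Proof. by move=> rp; apply: prod_itv01 => s; exact: wt_itv. Qed.

Lemma expeR_hamiltonian psi x : pot_repulsive psi ->
  expeR (- hamiltonian psi x) = (boltz psi x)%:E.
Proof.
move=> rp; rewrite /hamiltonian big_mkcond /=.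
pose G s := if nilp s then 0%E else psi s.
transitivity (expeR (- \sum_(s <- subs x) G s)%E).
  rewrite -big_subseqS; congr (expeR (- _)%E); apply: eq_bigr => S _.
  by rewrite /G /nilp size_map -cardE lt0n; case: eqP.
rewrite expeRN_sum => [|s]; last by rewrite /G; case: nilP => // /rp.
congr EFin; apply: eq_bigr => s _; rewrite /G /wt; case: nilp => //.
by rewrite oppe0 /= expR0.
Qed.

Lemma pin_repulsive psi w : pot_repulsive psi -> pot_repulsive (pin psi w).
Proof.
by move=> rp s s0; rewrite /pin sume_ge0// => S _; apply: rp; case: s s0.
Qed.

Lemma wt_pin psi w v : pot_repulsive psi -> v <> [::] ->
  wt (pin psi w) v = \prod_(s <- subs w) wt psi (v ++ s).
Proof.
case: v => // a v rp _; rewrite /wt /= /pin.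
rewrite (big_subseqS _ _ (fun s => psi ((a :: v) ++ s))) /=.
by rewrite expeRN_sum// => s; exact: rp.
Qed.

Lemma pot_symmetricP psi : pot_symmetric psi -> perm_invariant psi.
Proof.
move=> sp s t st; have /tuple_permP[p ->] : perm_eq s (in_tuple t) by [].
by rewrite -[RHS](sp _ (in_tuple t) p).
Qed.

Lemma wt_perm psi : pot_symmetric psi -> perm_invariant (wt psi).
Proof.
move=> /pot_symmetricP sp s t st.
by rewrite /wt /nilp (perm_size st) (sp _ _ st).
Qed.

Lemma big_subs_nil (A : Type) (idx : A) (op : Monoid.com_law idx) v (F : seq X -> A) :
  \big[op/idx]_(s <- subs v) F s =
  op (F [::]) (\big[op/idx]_(s <- subs v) if nilp s then idx else F s).
Proof.
elim: v => [|a v IH]; first by rewrite !big_seq1 /= Monoid.mulm1.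
by rewrite !big_subs_cons IH /= Monoid.mulmCA.
Qed.

(** By symmetry [x] may be replaced by p.2 ++ p.1. Subsequences with empty part in p.2 give the
    energy of p.1; those with a nonempty part in p.2, together with an arbitrary part in p.1, give
    the energy of p.2 under pinning at p.1. *)
Lemma boltz_split psi x p : pot_symmetric psi -> pot_repulsive psi ->
  p \in splits x -> boltz psi x = boltz psi p.1 * boltz (pin psi p.1) p.2.
Proof.
move=> sp rp /splits_perm px; rewrite /boltz.
have px' : perm_eq x (p.2 ++ p.1) by rewrite perm_sym perm_catC perm_sym.
rewrite (perm_big_subs _ (wt_perm sp) px') big_subs_cat big_subs_nil /=.
congr (_ * _); apply: eq_bigr => s _; case: ifPn => [/nilP -> //|/nilP s0].
by rewrite wt_pin.
Qed.

Section PartialPinning.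
Variables (dist : X -> X -> R) (z : X) (phi : @potential R d X) (y : X).
Hypotheses (sp : pot_symmetric phi) (rp : pot_repulsive phi).
Let D := Dz dist z.

(** This is the factor that [s] gains once [y] is pinned to it. The value 1 at the empty sequence
    keeps phi(y) itself out, and later makes the term of the empty [w] vanish. *)
Definition pinwt s : R := if nilp s then 1 else wt phi (y :: s).

Lemma pinwt_itv s : 0 <= pinwt s <= 1.
Proof. by rewrite /pinwt; case: nilp; [rewrite ler01 lexx|exact: wt_itv]. Qed.

Lemma wt_ppin t s : wt (ppin dist z phi y t) s =
  wt phi s * (if ((D s)%:E < t)%E then pinwt s else 1).
Proof.
rewrite /pinwt; case: s => [|a s]; first by rewrite /wt /= if_same mulr1.
rewrite /= {1}/wt /= /ppin -/D; case: ifPn => _; last by rewrite mulr1.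
have := @wt_pin phi [:: y] (a :: s) rp; rewrite {1}/wt /= => -> //.
rewrite !big_cons big_nil cats0 mulr1 mulrC; congr (_ * _).
(* [pin] appends [y] at the end while [main_integrand] puts it in front; symmetry identifies the
   two. *)
by apply: (wt_perm sp); rewrite cats1 perm_sym -rcons_cons -perm_rcons.
Qed.

Lemma boltz_ppin t x : boltz (ppin dist z phi y t) x =
  boltz phi x * \prod_(s <- subs x | ((D s)%:E < t)%E) pinwt s.
Proof.
rewrite /boltz [X in _ * X]big_mkcond /= -big_split /=.
by apply: eq_bigr => s _; exact: wt_ppin.
Qed.

(** Here [w] is the subsequence whose pinning factor is switched on between the thresholds and [v]
    is the rest. Integrating out [v] will produce the partition function pinned at [w], the
    numerator of kappa. *)
Definition incr_weight (s t : \bar R) w v : R :=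
  if (s <= (D w)%:E < t)%E then
    (1 - pinwt w) * boltz (ppinw dist z phi y w) w *
    boltz (pin (ppinw dist z phi y w) w) v
  else 0.

(** Both sides are expanded by [telescope_prod]: terms with D w < s cancel, and terms with D w >= t
    occur in neither expansion. *)
Lemma boltz_ppin_incr (s t : \bar R) x :
  (forall w, pot_symmetric (ppinw dist z phi y w) /\
             pot_repulsive (ppinw dist z phi y w)) ->
  (s <= t)%E -> uniq (map D (subs x)) ->
  boltz (ppin dist z phi y s) x =
  boltz (ppin dist z phi y t) x + \sum_(p <- splits x) incr_weight s t p.1 p.2.
Proof.
move=> good st ux; rewrite !boltz_ppin; apply/eqP; rewrite addrC -subr_eq; apply/eqP.
rewrite -mulrBr.
set Q := fun r : \bar R => \prod_(s0 <- subs x | ((D s0)%:E < r)%E) pinwt s0.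
rewrite -[X in _ * X]/(Q s - Q t).
have -> : Q s - Q t = (1 - Q t) - (1 - Q s) by ring.
rewrite /Q !(telescope_prod _ _ ux).
rewrite [X in _ * (X - _)]big_mkcond [X in _ * (_ - X)]big_mkcond /= -sumrB.
rewrite mulr_sumr subs_splits big_map big_seq [RHS]big_seq.
apply: eq_bigr => p px; rewrite /incr_weight.
(* The factors already switched on strictly below D w are those of the potential partially pinned at
   [w], so [boltz_split] applies to that potential. *)
have key : boltz phi x * \prod_(s' <- [seq p.1 | p <- splits x] | D s' < D p.1) pinwt s' =
    boltz (ppinw dist z phi y p.1) p.1 * boltz (pin (ppinw dist z phi y p.1) p.1) p.2.
  have [sw rw] := good p.1; rewrite -(boltz_split sw rw px) /ppinw boltz_ppin.
  by rewrite subs_splits.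
case: (ltP (D p.1)%:E s) => sp1 /=.
  by rewrite (lt_le_trans sp1 st) subrr mulr0.
by case: ifPn => _; rewrite subr0 ?mulr0// mulrCA key mulrA.
Qed.

Lemma incr_weight_itv (s t : \bar R) w v :
  pot_repulsive (ppinw dist z phi y w) -> 0 <= incr_weight s t w v <= 1.
Proof.
move=> rw; rewrite /incr_weight; case: ifP => _; last by rewrite lexx ler01.
have /andP[a0 a1] := pinwt_itv w.
have /andP[b0 b1] := boltz_itv w rw.
have /andP[c0 c1] := boltz_itv v (@pin_repulsive _ w rw).
have a2 : 0 <= 1 - pinwt w by lra.
have a3 : 1 - pinwt w <= 1 by lra.
by rewrite !mulr_ge0//= !mulr_ile1// mulr_ge0.
Qed.

End PartialPinning.
End Boltzmann.

(** * Measurability on finite sequences *)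

Section SequenceMeasurability.
Context (R : realType) (d : measure_display) (X : measurableType d).

(** [seq X] is given no sigma-algebra. A measurable family of sequences is therefore generated from
    measurable coordinates, which forces a constant length and permits induction on the family. *)
Inductive seq_meas (d' : measure_display) (T : measurableType d') :
    (T -> seq X) -> Prop :=
| seq_meas_nil : seq_meas (fun=> [::])
| seq_meas_cons (x : T -> X) h : measurable_fun setT x -> seq_meas h ->
    seq_meas (fun t => x t :: h t).

Section OneDomain.
Context (d' : measure_display) (T : measurableType d').

Lemma seq_meas_tuple n (h : T -> n.-tuple X) : measurable_fun setT h ->
  seq_meas (fun t => tval (h t)).
Proof.
elim: n h => [|n IH] h mh.
  rewrite (_ : (fun _ => _) = fun=> [::]); first exact: seq_meas_nil.
  by apply/funext => t; rewrite (tuple0 (h t)).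
rewrite (_ : (fun _ => _) = fun t => thead (h t) :: tval [tuple of behead (h t)]).
  apply: (seq_meas_cons (x := fun t => thead (h t))).
    exact: (measurableT_comp (measurable_tnth ord0)).
  apply: IH; exact: (measurableT_comp (@measurable_behead _ X n) mh).
by apply/funext => t; rewrite {1}(tuple_eta (h t)).
Qed.

Lemma seq_measP (h : T -> seq X) : seq_meas h ->
  exists n (h' : T -> n.-tuple X), measurable_fun setT h' /\ forall t, h t = h' t.
Proof.
elim => [|x {}h mx _ [n [h' [mh' hh']]]].
  by exists 0%N, (fun=> [tuple]); split.
exists n.+1, (fun t => [tuple of x t :: h' t]); split => [|t]; last by rewrite hh'.
exact: measurable_cons.
Qed.

Lemma seq_meas_cat (h1 h2 : T -> seq X) : seq_meas h1 -> seq_meas h2 ->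
  seq_meas (fun t => h1 t ++ h2 t).
Proof. by move=> m1 m2; elim: m1 => //= x h mx _ IH; exact: seq_meas_cons. Qed.

Lemma seq_meas_cst s : seq_meas (fun _ : T => s).
Proof. by elim: s => [|a s IH]; [exact: seq_meas_nil|exact: seq_meas_cons]. Qed.

Lemma seq_meas_size (h : T -> seq X) : seq_meas h -> exists n, forall t, size (h t) = n.
Proof.
by elim => [|x {}h _ _ [n hn]]; [exists 0%N | exists n.+1 => t /=; rewrite hn].
Qed.

(** [F] sees the parameter [t] besides the subsequence, so that the induction can absorb the head
    [x t] into [F]. *)
Lemma measurable_prod_subs (h : T -> seq X) (F : seq X -> T -> R) : seq_meas h ->
  (forall h', seq_meas h' -> measurable_fun setT (fun t => F (h' t) t)) ->
  measurable_fun setT (fun t => \prod_(s <- subs (h t)) F s t).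
Proof.
move=> mh; elim: mh F => [|x {}h mx _ IH] F mF.
  by under eq_fun do rewrite big_seq1; exact/mF/seq_meas_nil.
under eq_fun do rewrite big_subs_cons.
apply: measurable_funM; last exact: IH.
apply: (IH (fun s t => F (x t :: s) t)) => h' mh'.
exact/mF/seq_meas_cons.
Qed.

Lemma measurable_if_nil (h : T -> seq X) (f g : T -> R) :
  seq_meas h -> measurable_fun setT f -> measurable_fun setT g ->
  measurable_fun setT (fun t => if nilp (h t) then f t else g t).
Proof.
move=> /seq_meas_size[n hn] mf mg.
by under eq_fun do rewrite /nilp hn; case: eqP.
Qed.

End OneDomain.

Lemma seq_meas_comp d1 d2 (T1 : measurableType d1) (T2 : measurableType d2)
    (g : T1 -> T2) (h : T2 -> seq X) : measurable_fun setT g ->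
  seq_meas h -> seq_meas (fun t => h (g t)).
Proof.
move=> mg; elim => [|x {}h mx _ IH]; first exact: seq_meas_nil.
apply: (seq_meas_cons (x := fun t => x (g t))) => //.
exact: measurableT_comp mx mg.
Qed.

Lemma measurable_comp_seq d' (T : measurableType d') d2 (U : measurableType d2)
    (F : seq X -> U) (h : T -> seq X) :
  (forall k, measurable_fun [set: k.-tuple X] (fun t => F (tval t))) ->
  seq_meas h -> measurable_fun setT (fun t => F (h t)).
Proof.
move=> mF /seq_measP[n [h' [mh' hh']]]; under eq_fun do rewrite hh'.
exact: measurableT_comp (mF n) mh'.
Qed.

Lemma measurable_expeRN :
  measurable_fun [set: \bar R] (fun e => fine (expeR (- e)) : R).
Proof.
rewrite (_ : (fun _ => _) = fun e : \bar R => if e == +oo%E then 0 else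
    if e == -oo%E then 0 else expR (- fine e)); last by apply/funext => -[].
apply: measurable_fun_ifT => //; first exact: measurable_fun_eqe.
apply: measurable_fun_ifT => //; first exact: measurable_fun_eqe.
by apply: measurableT_comp => //; apply: measurableT_comp => //.
Qed.

Section Potential.
Context (d' : measure_display) (T : measurableType d').
Variables (dist : X -> X -> R) (z : X) (phi : @potential R d X) (y : X).
Hypotheses (mdist : measurable_fun setT (dist z)) (sp : pot_symmetric phi)
  (rp : pot_repulsive phi) (mp : pot_measurable phi).
Let D := Dz dist z.

Lemma measurable_Dz (h : T -> seq X) : seq_meas h ->
  measurable_fun setT (fun t => D (h t)).
Proof.
elim => [|x {}h mx _ IH]; rewrite /D /Dz.
  by under eq_fun do rewrite big_nil; exact: measurable_cst.
under eq_fun do rewrite big_cons; apply: measurable_funD => //.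
exact: measurableT_comp mdist mx.
Qed.

Lemma measurable_wt (h : T -> seq X) : seq_meas h ->
  measurable_fun setT (fun t => wt phi (h t)).
Proof.
move=> mh; rewrite /wt; apply: measurable_if_nil => //.
exact: measurableT_comp measurable_expeRN (measurable_comp_seq mp mh).
Qed.

Lemma measurable_pinwt (h : T -> seq X) : seq_meas h ->
  measurable_fun setT (fun t => pinwt phi y (h t)).
Proof.
move=> mh; rewrite /pinwt; apply: measurable_if_nil => //.
by apply: measurable_wt; apply: seq_meas_cons.
Qed.

Lemma measurable_wt_ppin (r : T -> \bar R) (h : T -> seq X) :
  measurable_fun setT r -> seq_meas h ->
  measurable_fun setT (fun t => wt (ppin dist z phi y (r t)) (h t)).
Proof.
move=> mr mh; under eq_fun do rewrite wt_ppin//.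
apply: measurable_funM; first exact: measurable_wt.
apply: measurable_fun_ifT => //; last exact: measurable_pinwt.
by apply: measurable_fun_lte => //; apply/measurable_EFinP; exact: measurable_Dz.
Qed.

Lemma measurable_boltz_ppin (r : T -> \bar R) (h : T -> seq X) :
  measurable_fun setT r -> seq_meas h ->
  measurable_fun setT (fun t => boltz (ppin dist z phi y (r t)) (h t)).
Proof.
move=> mr mh.
apply: (measurable_prod_subs (F := fun s t => wt (ppin dist z phi y (r t)) s)) => // h' mh'.
exact: measurable_wt_ppin.
Qed.

Lemma measurable_boltz_pin (r : T -> \bar R) (w v : T -> seq X) :
  (forall t, pot_repulsive (ppin dist z phi y (r t))) ->
  measurable_fun setT r -> seq_meas w -> seq_meas v ->
  measurable_fun setT (fun t => boltz (pin (ppin dist z phi y (r t)) (w t)) (v t)).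
Proof.
move=> rr mr mw mv.
apply: (measurable_prod_subs
  (F := fun s t => wt (pin (ppin dist z phi y (r t)) (w t)) s)) => // h mh.
rewrite (_ : (fun _ => _) = fun t => if nilp (h t) then 1 else
    \prod_(s <- subs (w t)) wt (ppin dist z phi y (r t)) (h t ++ s)); last first.
  apply/funext => t; case: ifPn => [/nilP ->//|/nilP ht]; exact: wt_pin.
apply: measurable_if_nil => //.
apply: (measurable_prod_subs
  (F := fun s t => wt (ppin dist z phi y (r t)) (h t ++ s))) => // h' mh'.
by apply: measurable_wt_ppin => //; exact: seq_meas_cat.
Qed.

Lemma measurable_incr_weight (s t : \bar R) (w v : T -> seq X) :
  (forall u, pot_repulsive (ppinw dist z phi y u)) ->
  seq_meas w -> seq_meas v ->
  measurable_fun setT (fun x => incr_weight dist z phi y s t (w x) (v x)).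
Proof.
move=> rr mw mv; rewrite /incr_weight -/D.
have mD : measurable_fun setT (fun x => (D (w x))%:E).
  by apply/measurable_EFinP; exact: measurable_Dz.
apply: measurable_fun_ifT => //.
  apply: measurable_and.
    exact: (measurable_fun_lee (measurable_cst s) mD).
  exact: (measurable_fun_lte mD (measurable_cst t)).
apply: measurable_funM; last first.
  by apply: (measurable_boltz_pin (r := fun x => (D (w x))%:E)) => // x; exact: rr.
apply: measurable_funM; last first.
  exact: (measurable_boltz_ppin (r := fun x => (D (w x))%:E)).
by apply: measurable_funB => //; exact: measurable_pinwt.
Qed.

End Potential.
End SequenceMeasurability.

Section MetricMeasurability.
Context (R : realType) (d : measure_display) (X : measurableType d).

Lemma dist_measurable (dist : X -> X -> R) z : is_metric dist ->
  borel_for dist -> measurable_fun setT (dist z).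
Proof.
move=> [d0 deq0 dsym dtri] bd.
apply: (measurability _ (RGenInftyO.measurableE R)) => _ [_ [r ->] <-].
rewrite setTI; apply/bd; apply: sub_sigma_algebra => x /=.
rewrite in_itv /= => xr; exists (r - dist z x); first by rewrite subr_gt0.
move=> y xy; rewrite in_itv /=; apply: le_lt_trans (dtri z x y) _; lra.
Qed.

End MetricMeasurability.

(** * Product measures *)

Section PowerMeasure.
Local Open Scope ereal_scope.
Context (R : realType) (d : measure_display) (X : measurableType d).
Variable nu : {finite_measure set X -> \bar R}.

Definition cons_pair k (p : X * k.-tuple X) : k.+1.-tuple X := [tuple of p.1 :: p.2].

Lemma measurable_cons_pair k : measurable_fun setT (@cons_pair k).
Proof. exact: (measurable_cons measurable_fst measurable_snd). Qed.

Section Cons.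
Variables (k : nat) (m : {finite_measure set (k.-tuple X) -> \bar R}).

Definition consm : set (k.+1.-tuple X) -> \bar R := pushforward (nu \x m) (@cons_pair k).

Let pm : {measure set (k.+1.-tuple X) -> \bar R} :=
  measure_function_pushforward__canonical__measure_function_Measure
    (nu \x m) (@measurable_cons_pair k).

Let consm0 : consm set0 = 0. Proof. exact: (measure0 pm). Qed.
Let consm_ge0 A : 0 <= consm A. Proof. exact: (measure_ge0 pm). Qed.
Let consm_sigma : semi_sigma_additive consm.
Proof. exact: (@measure_semi_sigma_additive _ _ _ pm). Qed.

HB.instance Definition _ := isMeasure.Build _ _ _ consm consm0 consm_ge0 consm_sigma.

Lemma consm_setT : consm setT = nu setT * m setT.
Proof. by rewrite /consm /pushforward preimage_setT -setXTT product_measure1E. Qed.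

Let consm_fin : fin_num_fun consm.
Proof.
move=> A mA; rewrite ge0_fin_numE//.
apply: (@le_lt_trans _ _ (consm setT)); first by apply: (@le_measure _ _ _ pm) => //; apply/mem_set.
by rewrite consm_setT -ge0_fin_numE ?mule_ge0// fin_numM// fin_num_measure.
Qed.

HB.instance Definition _ := Measure_isFinite.Build _ _ _ consm consm_fin.
End Cons.

(** The recursion is that of [prodm], but the values are bundled finite measures, so that Tonelli's
    theorem applies; [prodm] is a bare set function. *)
Fixpoint pw k : {finite_measure set (k.-tuple X) -> \bar R} :=
  match k return {finite_measure set (k.-tuple X) -> \bar R} with
  | 0 => \d_ [tuple]
  | k'.+1 => consm (pw k')
  end.

Lemma pw_setT k : pw k setT = (fine (nu setT) ^+ k)%:E.
Proof.
elim: k => [|k IH] /=; first by rewrite diracT expr0.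
by rewrite consm_setT IH exprS EFinM fineK// fin_num_measure.
Qed.

Lemma pw0_integral (f : 0.-tuple X -> \bar R) : \int[pw 0]_w f w = f [tuple].
Proof.
rewrite /= integral_dirac// ?diracT ?mul1e//.
move=> _ Y _; have [h|h] := pselect (Y (f [tuple])).
  rewrite (_ : _ `&` _ = setT)//; apply/seteqP; split => // t _.
  by split => //=; rewrite (tuple0 t).
rewrite (_ : _ `&` _ = set0)//; apply/seteqP; split => // t [_ /=].
by rewrite (tuple0 t).
Qed.

Lemma pwS_integral k (f : k.+1.-tuple X -> \bar R) :
  measurable_fun setT f -> (forall w, 0 <= f w) ->
  \int[pw k.+1]_w f w = \int[nu]_x \int[pw k]_v f (cons_pair (x, v)).
Proof.
move=> mf f0; rewrite /= /consm.
rewrite (ge0_integral_pushforward (measurable_cons_pair (k := k)))//.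
rewrite preimage_setT fubini_tonelli1//; last by move=> p; exact: f0.
exact: (measurableT_comp mf (measurable_cons_pair (k := k))).
Qed.

Lemma pwS_integralC k (f : k.+1.-tuple X -> \bar R) :
  measurable_fun setT f -> (forall w, 0 <= f w) ->
  \int[pw k.+1]_w f w = \int[pw k]_v \int[nu]_x f (cons_pair (x, v)).
Proof.
move=> mf f0; rewrite pwS_integral//.
apply: (@fubini_tonelli _ _ _ _ _ nu (pw k) (fun p => f (cons_pair p))) => //.
exact: (measurableT_comp mf (measurable_cons_pair (k := k))).
Qed.

Lemma measurable_pw_param d' (T : measurableType d') k (f : T -> k.-tuple X -> \bar R) :
  measurable_fun [set: T * k.-tuple X] (fun p => f p.1 p.2) ->
  (forall t w, 0 <= f t w) ->
  measurable_fun setT (fun t => \int[pw k]_w f t w).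
Proof.
move=> mf f0.
exact: (@measurable_fun_fubini_tonelli_F _ _ _ _ _ (pw k) (fun p => f p.1 p.2)).
Qed.

(** Joint measurability in two sequences of any lengths, tested along all measurable families; the
    form is stable under moving points between the arguments. *)
Definition meas2 (F : seq X -> seq X -> \bar R) :=
  forall d' (T : measurableType d') (h1 h2 : T -> seq X), seq_meas h1 -> seq_meas h2 ->
    measurable_fun setT (fun t => F (h1 t) (h2 t)).

Lemma seq_meas_tval k : seq_meas (fun t : k.-tuple X => tval t).
Proof. exact: (seq_meas_tuple (h := id)). Qed.

Lemma measurable_int_snd d' (T : measurableType d') k F (h1 : T -> seq X) (x : T -> X) :
  meas2 F -> (forall w v, 0 <= F w v) -> seq_meas h1 -> measurable_fun setT x ->
  measurable_fun setT (fun t => \int[pw k]_v F (h1 t) (x t :: v)).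
Proof.
move=> mF F0 m1 mx; apply: (measurable_pw_param (f := fun t v => F (h1 t) (x t :: v))) => //.
apply: mF; first exact: seq_meas_comp m1.
apply: (seq_meas_cons (x := fun p : T * k.-tuple X => x p.1)).
  exact: measurableT_comp mx measurable_fst.
exact: seq_meas_comp measurable_snd (seq_meas_tval k).
Qed.

Lemma measurable_int2 d' (T : measurableType d') k F (h1 : T -> seq X) :
  meas2 F -> (forall w v, 0 <= F w v) -> seq_meas h1 ->
  measurable_fun setT (fun t => \int[pw k]_v F (h1 t) v).
Proof.
move=> mF F0 m1; apply: (measurable_pw_param (f := fun t v => F (h1 t) v)) => //.
apply: mF; first exact: seq_meas_comp m1.
exact: seq_meas_comp measurable_snd (seq_meas_tval k).
Qed.

Lemma measurable_splits d' (T : measurableType d') F (h : T -> seq X) :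
  meas2 F -> seq_meas h ->
  measurable_fun setT (fun t => \sum_(p <- splits (h t)) F p.1 p.2).
Proof.
move=> mF mh.
(* The prefixes [h1] and [h2] are accumulators: the head of the sequence moves onto one of them, and
   the induction hypothesis still applies. *)
suff : forall h1 h2, seq_meas h1 -> seq_meas h2 -> measurable_fun setT
    (fun t => \sum_(p <- splits (h t)) F (h1 t ++ p.1) (h2 t ++ p.2)).
  by move=> /(_ _ _ (seq_meas_nil X T) (seq_meas_nil X T)).
elim: mh => [|x {}h mx _ IH] h1 h2 m1 m2.
  under eq_fun do rewrite big_seq1 !cats0; exact: mF.
under eq_fun do rewrite (big_splits_cons _ _ _ (fun a b => F (_ ++ a) (_ ++ b))).
have mr (g : T -> seq X) : seq_meas g -> seq_meas (fun t => g t ++ [:: x t]).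
  by move=> mg; apply: seq_meas_cat => //; apply: seq_meas_cons => //; exact: seq_meas_nil.
apply: emeasurable_funD.
  under eq_fun do under eq_bigr do rewrite -cat_rcons -cats1.
  by apply: IH => //; exact: mr.
under eq_fun do under eq_bigr do rewrite -cat_rcons -cats1.
by apply: IH => //; exact: mr.
Qed.

(** Pascal's rule in the shape met by the induction below: a new point joins either the part of size
    j or its complement. *)
Lemma sum_pascal (V : nmodType) k (A : nat -> nat -> V) :
  (\sum_(j < k.+1) (A j.+1 (k - j)%N + A j (k - j).+1) *+ 'C(k, j) =
  \sum_(j < k.+2) A j (k.+1 - j)%N *+ 'C(k.+1, j))%R.
Proof.
rewrite [RHS]big_ord_recl bin0 subn0 /=.
under [in RHS]eq_bigr do rewrite /bump /= add1n binS subSS mulrnDr.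
rewrite [in RHS]big_split /= [X in _ = (_ + (X + _))%R]big_ord_recr /=.
rewrite (@bin_small k k.+1)// mulr0n addr0.
under [in LHS]eq_bigr do rewrite mulrnDl.
rewrite big_split /= [X in (_ + X = _)%R]big_ord_recl bin0 subn0 addrC -!addrA.
congr (_ + (_ + _))%R; apply: eq_bigr => j _.
by rewrite /= subnSK.
Qed.

Lemma natmule (e : \bar R) n : (e *+ n)%R = n%:R%:E * e.
Proof. by rewrite mule_natl. Qed.

Lemma integral_natmul d' (T : measurableType d') (m : {measure set T -> \bar R})
    (f : T -> \bar R) n : measurable_fun setT f -> (forall t, 0 <= f t) ->
  \int[m]_t (f t *+ n)%R = ((\int[m]_t f t)%E *+ n)%R.
Proof.
move=> mf f0; under eq_integral do rewrite natmule.
by rewrite ge0_integralZl_EFin// natmule.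
Qed.

Lemma natmule_ge0 (e : \bar R) n : 0 <= e -> 0 <= (e *+ n)%R.
Proof. by move=> e0; rewrite natmule mule_ge0. Qed.

(** All splits with a first part of size j have the same integral under a product measure, and there
    are C(k, j) of them. The induction places the first coordinate on one side or the other. *)
Lemma split_integral k F : meas2 F -> (forall w v, 0 <= F w v) ->
  \int[pw k]_x (\sum_(p <- splits x) F p.1 p.2) =
  (\sum_(j < k.+1) (\int[pw j]_w \int[pw (k - j)]_v F w v)%E *+ 'C(k, j))%R.
Proof.
elim: k F => [|k IH] F mF F0.
  rewrite pw0_integral big_seq1 big_ord1 bin0 mulr1n subn0.
  by rewrite !pw0_integral.
rewrite pwS_integral; first last.
- by move=> w; exact: sume_ge0.
- exact: measurable_splits (seq_meas_tval k.+1).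
(* The two placements of the first point [x], gathered so that the induction hypothesis can be used
   for fixed [x]. *)
pose F' x w v := F (x :: w) v + F w (x :: v).
have F'0 x w v : 0 <= F' x w v by exact: adde_ge0.
have mF' x : meas2 (F' x).
  move=> d' T h1 h2 m1 m2; apply: emeasurable_funD; apply: mF => //;
  exact: seq_meas_cons.
transitivity (\int[nu]_x (\sum_(j < k.+1)
    (\int[pw j]_w \int[pw (k - j)]_v F' x w v)%E *+ 'C(k, j))%R).
  apply: eq_integral => x _; rewrite -IH//; apply: eq_integral => v _.
  by rewrite [LHS](big_splits_cons _ _ _ F) big_split.
rewrite -(sum_pascal k (fun j m => \int[pw j]_w \int[pw m]_v F w v)).
have mcons d' (T : measurableType d') (x : T -> X) (h : T -> seq X) :
  measurable_fun setT x -> seq_meas h -> seq_meas (fun t => x t :: h t).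
  by move=> *; exact: seq_meas_cons.
have i0 j m x : 0 <= \int[pw j]_w \int[pw m]_v F' x w v.
  by apply: integral_ge0 => w _; exact: integral_ge0.
have mF2 j m : measurable_fun setT (fun x => \int[pw j]_w \int[pw m]_v F (x :: w) v).
  apply: (measurable_pw_param (f := fun x w => \int[pw m]_v F (x :: w) v)).
    apply: (@measurable_int2 _ _ _ _ (fun p : X * j.-tuple X => p.1 :: p.2)) => //.
    apply: (mcons _ _ fst) => //.
    exact: seq_meas_comp measurable_snd (seq_meas_tval j).
  by move=> *; exact: integral_ge0.
have mp2 j m : measurable_fun setT
    (fun p : X * j.-tuple X => \int[pw m]_v F p.2 (p.1 :: v)).
  apply: (@measurable_int_snd _ _ _ _ (fun p : X * j.-tuple X => tval p.2)) => //.
  exact: seq_meas_comp measurable_snd (seq_meas_tval j).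
have mF3 j m : measurable_fun setT (fun x => \int[pw j]_w \int[pw m]_v F w (x :: v)).
  apply: (measurable_pw_param (f := fun x w => \int[pw m]_v F w (x :: v))) => //.
  by move=> *; exact: integral_ge0.
have F'E j m x : \int[pw j]_w \int[pw m]_v F' x w v =
    \int[pw j]_w \int[pw m]_v F (x :: w) v + \int[pw j]_w \int[pw m]_v F w (x :: v).
  rewrite -ge0_integralD//; first last.
  - apply: (@measurable_int_snd _ _ _ _ _ (fun=> x)) => //; exact: seq_meas_tval.
  - by move=> *; exact: integral_ge0.
  - apply: (@measurable_int2 _ _ _ _ (fun w : j.-tuple X => x :: w)) => //.
    by apply: (mcons _ _ (fun=> x)) => //; exact: seq_meas_tval.
  - by move=> *; exact: integral_ge0.
  apply: eq_integral => w _; rewrite -ge0_integralD//.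
  - apply: (mF _ _ (fun=> x :: w) (fun v : m.-tuple X => tval v)).
      exact: seq_meas_cst.
    exact: seq_meas_tval.
  - apply: (mF _ _ (fun=> tval w) (fun v : m.-tuple X => x :: tval v)).
      exact: seq_meas_cst.
    by apply: (mcons _ _ (fun=> x)) => //; exact: seq_meas_tval.
rewrite ge0_integral_sum//; first last.
- by move=> j x _; exact: natmule_ge0.
- move=> j; under eq_fun do rewrite natmule F'E.
  by apply: measurable_funeM; exact: emeasurable_funD.
apply: eq_bigr => j _; rewrite integral_natmul//; last first.
  by under eq_fun do rewrite F'E; exact: emeasurable_funD.
congr (_ *+ _)%R; under eq_integral do rewrite F'E.
rewrite ge0_integralD//; first last.
- by move=> *; apply: integral_ge0 => *; exact: integral_ge0.
- by move=> *; apply: integral_ge0 => *; exact: integral_ge0.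
congr (_ + _).
  rewrite [RHS]pwS_integral//.
  - apply: (@measurable_int2 _ _ _ _ (fun w : j.+1.-tuple X => tval w)) => //.
    exact: seq_meas_tval.
  - by move=> *; exact: integral_ge0.
(* When [x] joins [v], its integral must be moved inside that over [w] to become the first
   coordinate of the inner tuple. *)
rewrite (@fubini_tonelli _ _ _ _ _ nu (pw j) (fun p => \int[pw (k - j)]_v F p.2 (p.1 :: v)))//; last 2 first.
- exact: mp2.
- by move=> *; exact: integral_ge0.
apply: eq_integral => w _; rewrite [RHS]pwS_integral//.
apply: (mF _ _ (fun=> tval w) (fun v : (k - j).+1.-tuple X => tval v)).
  exact: seq_meas_cst.
exact: seq_meas_tval.
Qed.

End PowerMeasure.

(** * Restriction to the domain and null sets *)

Section Restriction.
Local Open Scope ereal_scope.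
Context (R : realType) (d : measure_display) (X : measurableType d).

Import HBNNSimple.

(** A nonnegative simple function below one that vanishes off [D] has its nonzero levels inside [D],
    so the supremum defining the integral sees the set functions only there. Nothing is asked of
    [m1] and [m2], which matters for [prodm]. *)
Lemma eq_setfun_integral d' (T : measurableType d') (m1 m2 : set T -> \bar R)
    (D : set T) (f : T -> \bar R) :
  (forall A, measurable A -> A `<=` D -> m1 A = m2 A) ->
  \int[m1]_(x in D) f x = \int[m2]_(x in D) f x.
Proof.
move=> m12.
have key (g : T -> \bar R) (h : {nnsfun T >-> R}) : (forall x, (h x)%:E <= (g \_ D) x) ->
    sintegral m1 h = sintegral m2 h.
  move=> hg; rewrite /sintegral; apply: eq_fsbigr => r _.
  have [->|r0] := eqVneq r 0%R; first by rewrite !mul0e.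
  congr (_ * _); apply: m12 => [|x /= hx]; first exact: measurable_sfunP.
  apply: contrapT => Dx; have := hg x; rewrite hx patchE memNset// lee_fin.
  by apply/negP; rewrite -ltNge lt_neqAle eq_sym r0 -hx fun_ge0.
rewrite /integral funepos_restrict funeneg_restrict.
by congr (ereal_sup _ - ereal_sup _); apply/seteqP; split => _ [h /= hg <-];
  exists h => //; rewrite (key _ h hg).
Qed.

Variables (nu : {measure set X -> \bar R}) (Lam : set X).
Hypotheses (mLam : measurable Lam) (nuLam : nu Lam < +oo).

(** Restricting the measure, rather than the domain of integration, gives a finite measure on all of
    X and integrals without side condition. *)
Definition nuL : {finite_measure set X -> \bar R} := mfrestr mLam nuLam.

Lemma nuLE A : nuL A = nu (A `&` Lam). Proof. by []. Qed.

Lemma integral_nuL (f : X -> \bar R) : measurable_fun setT f ->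
  \int[nuL]_x f x = \int[nu]_(x in Lam) f x.
Proof.
move=> mf; transitivity (\int[nuL]_(x in Lam) f x); last first.
  apply: eq_setfun_integral => A mA AL; rewrite nuLE; congr (nu _).
  exact/setIidPl.
rewrite [RHS]integral_mkcond; apply: ae_eq_integral => //.
  by apply/(measurable_restrictT _ mLam).1; exact: measurable_funTS.
exists (~` Lam); split; first exact: measurableC.
  by rewrite -[LHS]/(nu (~` Lam `&` Lam)) setICl measure0.
move=> x /= nx Lx; apply: nx => _; by rewrite patchE mem_set.
Qed.

Lemma measurable_powset k : measurable (@powset d X Lam k).
Proof.
rewrite (_ : @powset _ _ _ _ = \bigcap_(i in [set: 'I_k]) ((@tnth k X)^~ i @^-1` Lam)).
  apply: fin_bigcap_measurable => // i _; rewrite -[X in measurable X]setTI.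
  exact: measurable_tnth.
by apply/seteqP; split => w /= h i; [move=> _|]; exact: h.
Qed.

Let prodm0 k : @prodm R d X nu k set0 = 0.
Proof.
elim: k => [|k IH] /=; first by rewrite diracE in_set0.
rewrite /product_measure1 -[RHS](integral0 nu setT); apply: eq_integral => x _ /=.
by rewrite xsection0 IH.
Qed.

(** Sections of [A] at points outside [Lam] are empty, so integrating them against [nu] over X or
    against its restriction gives the same result. *)
Lemma prodm_restr k (A : set (k.-tuple X)) : measurable A ->
  A `<=` @powset d X Lam k -> prodm nu A = pw nuL k A.
Proof.
elim: k A => //= k IH A mA AL; rewrite /consm /pushforward /product_measure1.
set B := _ @^-1` A; have mB : measurable B.
  rewrite -[B]setTI; exact: (@measurable_cons_pair _ _ k).
rewrite [RHS]integral_nuL; last exact: measurable_fun_xsection.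
rewrite [RHS]integral_mkcond; apply: eq_integral => x _ /=.
rewrite patchE; case: ifPn => [xL|xL] /=.
  apply: IH; first exact: measurable_xsection.
  move=> v /xsectionP /AL h i.
  by have := h (lift ord0 i); rewrite tnthS.
rewrite (_ : xsection _ _ = set0) ?prodm0//; apply/seteqP; split => // v.
move=> /xsectionP /AL /(_ ord0); rewrite (tnth_nth x) /= => Lx.
by move/negP: xL; apply; exact: mem_set.
Qed.

Let pw_powsetC k : pw nuL k (~` @powset d X Lam k) = 0.
Proof.
have mP k' : measurable (~` @powset d X Lam k').
  by apply: measurableC; exact: measurable_powset.
elim: k => [|k IH].
  by rewrite /= diracE memNset//= => h; apply: h => -[].
rewrite /= /consm /pushforward /product_measure1 integral_nuL; last first.
  apply: measurable_fun_xsection; rewrite -[X in measurable X]setTI.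
  exact: (@measurable_cons_pair _ _ k measurableT _ (mP k.+1)).
rewrite -[RHS](integral0 nu Lam); apply: eq_integral => x /set_mem Lx /=.
rewrite -IH; congr (pw nuL k _); apply/seteqP; split => v.
  move=> /xsectionP h h'; apply: h => i; case: (unliftP ord0 i) => [j ->|->].
    by rewrite tnthS.
  by rewrite (tnth_nth x).
by move=> h; apply/xsectionP => h'; apply: h => i; have := h' (lift ord0 i); rewrite tnthS.
Qed.

Lemma integral_prodm k (f : k.-tuple X -> \bar R) : measurable_fun setT f ->
  \int[@prodm R d X nu k]_(w in @powset d X Lam k) f w = \int[pw nuL k]_w f w.
Proof.
move=> mf; have mP : measurable (@powset d X Lam k) by exact: measurable_powset.
rewrite (eq_setfun_integral (m2 := pw nuL k)); last exact: prodm_restr.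
rewrite integral_mkcond; apply: ae_eq_integral => //.
  have [+ _] := measurable_restrictT f mP; apply; exact: measurable_funTS.
exists (~` @powset d X Lam k); split; [exact: measurableC|exact: pw_powsetC|].
by move=> x /= nx Lx; apply: nx => _; rewrite patchE mem_set.
Qed.

End Restriction.

(** * Almost every configuration has pairwise distinct values of [Dz] *)

Section NullSets.
Local Open Scope ereal_scope.
Context (R : realType) (d : measure_display) (X : measurableType d).
Variables (nu : {finite_measure set X -> \bar R}) (dist : X -> X -> R) (z : X).
Hypotheses (mdist : measurable_fun setT (dist z))
  (ac : forall A : set R, measurable A -> lebesgue_measure A = 0 -> nu (dist z @^-1` A) = 0).
Let D := Dz dist z.

(** Tonelli with the first coordinate innermost: for each fixed tail it suffices to trap the first
    point in a null set. *)
Lemma pwS_null k (A : set (k.+1.-tuple X)) : measurable A ->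
  (forall v, exists N : set X, [/\ measurable N, nu N = 0 &
     forall x, A (cons_pair (x, v)) -> N x]) -> pw nu k.+1 A = 0.
Proof.
move=> mA h.
have -> : pw nu k.+1 A = \int[pw nu k.+1]_w (\1_A w)%:E.
  by rewrite integral_indic// setIT.
rewrite pwS_integralC; first last.
- by move=> w; rewrite lee_fin.
- exact/measurable_EFinP/measurable_indic.
rewrite -[RHS](integral0 (pw nu k) setT); apply: eq_integral => v _.
have [N [mN N0 AN]] := h v; apply/eqP; rewrite eq_le; apply/andP; split; last first.
  by apply: integral_ge0 => x _; rewrite lee_fin.
have -> : 0 = \int[nu]_x (\1_N x)%:E by rewrite integral_indic// setIT.
apply: ge0_le_integral => //.
- apply/measurable_EFinP; apply: (@measurableT_comp _ _ _ _ _ _ (\1_A : _ -> R) _ (fun x => cons_pair (x, v))).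
    exact: measurable_indic.
  exact: (measurable_cons (@measurable_id _ X setT) (measurable_cst v)).
- exact/measurable_EFinP/measurable_indic.
- move=> x _; rewrite lee_fin !indicE.
  by case: (boolP (_ \in A)) => // /set_mem /AN Nx; rewrite mem_set.
Qed.

Lemma pwS_null2 k (A : set (k.+1.-tuple X)) : measurable A ->
  (forall x, pw nu k [set v | A (cons_pair (x, v))] = 0) -> pw nu k.+1 A = 0.
Proof.
move=> mA h; rewrite /= /consm /pushforward /product_measure1.
rewrite -[RHS](integral0 nu setT); apply: eq_integral => x _ /=.
rewrite -[RHS](h x); congr (pw nu k _).
by apply/seteqP; split => v; [move/xsectionP|move=> Av; apply/xsectionP].
Qed.

(** For a fixed tail the first point lies on a sphere around [z], which is null since a single
    radius is Lebesgue-null. This will exclude atoms of [rho]. *)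
Lemma pw_Dz_eq k c : pw nu k.+1 [set w : k.+1.-tuple X | D w = c] = 0.
Proof.
apply: pwS_null => [|v].
  have := measurable_Dz mdist (@seq_meas_tval _ X k.+1).
  move=> /(_ measurableT [set c] (measurable_set1 c)).
  by rewrite setTI.
exists (dist z @^-1` [set c - D v]%R); split.
- by rewrite -[X in measurable X]setTI; exact: mdist.
- by apply: ac => //; exact: lebesgue_measure_set1.
- by move=> x /=; rewrite /D /Dz big_cons => <-; rewrite addrK.
Qed.

(** The recursion isolates the distance of the new point: given a generic tail, failure confines
    [dist z a] to finitely many values. *)
Fixpoint generic (x : seq X) : bool := if x is a :: s then
  generic s && all (fun u => all (fun v => (dist z a + D u)%R != D v) (subs s)) (subs s)
  else true.

Lemma generic_uniq x : generic x -> uniq (map D (subs x)).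
Proof.
elim: x => //= a s IH /andP[/IH us /allP h]; rewrite map_cat cat_uniq us andbT.
have E u : D (a :: u) = (dist z a + D u)%R by rewrite /D /Dz big_cons.
rewrite -map_comp; apply/andP; split.
  rewrite (_ : map _ _ = map (fun r => dist z a + r)%R (map D (subs s))).
    by rewrite map_inj_uniq// => r r' /addrI.
  by rewrite -map_comp; apply: eq_map => u /=; exact: E.
apply/hasPn => _ /mapP[v vs ->]; apply/mapP => -[u us' /=]; rewrite E => e.
by have /allP /(_ _ vs) := h _ us'; rewrite e eqxx.
Qed.

Let genr (x : seq X) : R := (generic x)%:R.

Let natr_all (T : Type) (P : pred T) (l : seq T) :
  ((all P l)%:R = \prod_(u <- l) (P u)%:R :> R)%R.
Proof. by elim: l => [|u l IH]; rewrite ?big_nil// big_cons -IH /= -mulnb natrM. Qed.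

Lemma measurable_generic d' (T : measurableType d') (h : T -> seq X) :
  seq_meas h -> measurable_fun setT (fun t => genr (h t)).
Proof.
elim => [|x {}h mx mh IH]; rewrite /genr /=; first exact: measurable_cst.
under eq_fun do rewrite -mulnb natrM natr_all.
apply: measurable_funM => //.
apply: (measurable_prod_subs (F := fun u t =>
  (all (fun v => (dist z (x t) + D u)%R != D v) (subs (h t)))%:R%R)) => // h1 mh1.
under eq_fun do rewrite natr_all.
apply: (measurable_prod_subs (F := fun v t =>
  ((dist z (x t) + D (h1 t))%R != D v)%:R%R)) => // h2 mh2.
rewrite (_ : (fun _ => _) = fun t =>
  if (dist z (x t) + D (h1 t))%R == D (h2 t) then 0%R else 1%R); last first.
  by apply/funext => t; case: eqP.
apply: measurable_fun_ifT => //; apply: measurable_fun_eqr.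
  apply: measurable_funD; first exact: measurableT_comp mdist mx.
  exact: measurable_Dz.
exact: measurable_Dz.
Qed.

Lemma measurable_generic_set k : measurable [set w : k.-tuple X | ~~ generic w].
Proof.
have := measurable_generic (@seq_meas_tval _ X k).
move=> /(_ measurableT [set 0%R] (measurable_set1 _)); rewrite setTI.
congr measurable; apply/seteqP; split => w /=; rewrite /genr.
  by case: generic => // /eqP; rewrite oner_eq0.
by move/negbTE => ->.
Qed.

Lemma pw_generic k : pw nu k [set w : k.-tuple X | ~~ generic w] = 0.
Proof.
elim: k => [|k IH].
  by rewrite /= diracE memNset.
pose B := [set w : k.+1.-tuple X | ~~ generic w].
(* [B1] has a bad tail and is null by induction; in [B2] the tail is good and the first point is to
   blame. *)
pose B1 := B `&` [set w : k.+1.-tuple X | ~~ generic (behead w)].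
pose B2 := B `&` [set w : k.+1.-tuple X | generic (behead w)].
have mb : measurable [set w : k.+1.-tuple X | ~~ generic (behead w)].
  have := @measurable_behead _ X k.
  by move=> /(_ measurableT _ (@measurable_generic_set k)); rewrite setTI.
have mB : measurable B by exact: measurable_generic_set.
have mB1 : measurable B1 by exact: measurableI.
have mB2 : measurable B2.
  apply: measurableI => //; rewrite (_ : mkset _ = ~` [set w : k.+1.-tuple X | ~~ generic (behead w)]).
    exact: measurableC.
  by apply/seteqP; split => w /=; [move=> -> | move/negP; rewrite negbK].
have -> : [set w : k.+1.-tuple X | ~~ generic w] = B1 `|` B2.
  apply/seteqP; split => [w Bw|w [[]|[]]//].
  by case: (boolP (generic (behead w))) => h; [right|left].
have e1 : pw nu k.+1 B1 = 0.
  apply: (subset_measure0 mB1 mb) => [w []//|].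
  by apply: pwS_null2 => // x; rewrite -[RHS]IH; congr (pw nu k _).
have e2 : pw nu k.+1 B2 = 0.
  apply: pwS_null => // v; have [gv|gv] := boolP (generic v); last first.
    exists set0; split => //.
    by move=> x [_ /=]; rewrite (negbTE gv).
  (* The finitely many radii at which the new point makes two subsequences collide. *)
  pose S := [set` [seq (D q - D p)%R | p <- subs v, q <- subs v]].
  have fS : finite_set S by exact: finite_seq.
  have mS : measurable S by exact: countable_measurable (finite_set_countable fS).
  exists (dist z @^-1` S); split.
  - by rewrite -[X in measurable X]setTI; exact: mdist.
  - apply: ac => //; exact: countable_lebesgue_measure0 (finite_set_countable fS).
  - move=> x [/= + _]; rewrite /B /= gv /= => /allPn[p ps /allPn[q qs]].
    rewrite negbK => /eqP e; rewrite /S /=; apply/allpairsP; exists (p, q).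
    by split => //=; rewrite -e addrK.
exact: null_set_setU.
Qed.

End NullSets.

(** * Complex series *)

Section ComplexSeries.
Context (R : realType).
Implicit Types (a b c w : R[i]) (u v : nat -> R[i]).
Local Notation Re := complex.Re.
Local Notation Im := complex.Im.

Lemma cReD a b : Re (a + b) = Re a + Re b. Proof. by case: a b => [? ?] []. Qed.
Lemma cImD a b : Im (a + b) = Im a + Im b. Proof. by case: a b => [? ?] []. Qed.
Lemma cReN a : Re (- a) = - Re a. Proof. by case: a. Qed.
Lemma cImN a : Im (- a) = - Im a. Proof. by case: a. Qed.
Lemma cReM a b : Re (a * b) = Re a * Re b - Im a * Im b.
Proof. by case: a b => [? ?] []. Qed.
Lemma cImM a b : Im (a * b) = Re a * Im b + Im a * Re b.
Proof. by case: a b => [? ?] []. Qed.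
Lemma cRe_sum (I : Type) (l : seq I) (F : I -> R[i]) :
  Re (\sum_(i <- l) F i) = \sum_(i <- l) Re (F i).
Proof. by elim/big_ind2: _ => // x ? y ? <- <-; rewrite cReD. Qed.
Lemma cIm_sum (I : Type) (l : seq I) (F : I -> R[i]) :
  Im (\sum_(i <- l) F i) = \sum_(i <- l) Im (F i).
Proof. by elim/big_ind2: _ => // x ? y ? <- <-; rewrite cImD. Qed.
Lemma ceqP a b : Re a = Re b -> Im a = Im b -> a = b.
Proof. by case: a b => [? ?] [? ?] /= -> ->. Qed.

(* The l1 norm: equivalent to the modulus, and still submultiplicative. *)
Definition nc w : R := `|Re w| + `|Im w|.

Lemma nc_ge0 w : 0 <= nc w. Proof. exact: addr_ge0. Qed.
Lemma ncRe w : `|Re w| <= nc w. Proof. by rewrite lerDl. Qed.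
Lemma ncIm w : `|Im w| <= nc w. Proof. by rewrite lerDr. Qed.
Lemma nc0 : nc 0 = 0. Proof. by rewrite /nc /= normr0 addr0. Qed.
Lemma ncN w : nc (- w) = nc w. Proof. by rewrite /nc cReN cImN !normrN. Qed.
Lemma ncBC a b : nc (a - b) = nc (b - a). Proof. by rewrite -ncN opprB. Qed.
Lemma nc_real (x : R) : nc x%:C%C = `|x|. Proof. by rewrite /nc /= normr0 addr0. Qed.
Lemma ncD a b : nc (a + b) <= nc a + nc b.
Proof. by rewrite /nc cReD cImD addrACA lerD// ler_normD. Qed.
Lemma ncM a b : nc (a * b) <= nc a * nc b.
Proof.
rewrite /nc cReM cImM; apply: le_trans (lerD (ler_normB _ _) (ler_normD _ _)) _.
by rewrite !normrM !mulrDl !mulrDr; lra.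
Qed.
Lemma nc_realM (x : R) a : 0 <= x -> nc (x%:C%C * a) = x * nc a.
Proof.
by move=> x0; rewrite /nc cReM cImM /= !mul0r subr0 addr0 !normrM ger0_norm// mulrDr.
Qed.
Lemma ncX a n : nc (a ^+ n) <= nc a ^+ n.
Proof.
elim: n => [|n IH]; first by rewrite !expr0 /nc /= normr0 normr1 addr0.
by rewrite !exprS; apply: le_trans (ncM _ _) _; rewrite ler_wpM2l// nc_ge0.
Qed.
Lemma nc_sum (I : Type) (l : seq I) (F : I -> R[i]) :
  nc (\sum_(i <- l) F i) <= \sum_(i <- l) nc (F i).
Proof.
elim/big_rec2: _ => [|i x y _ xy]; first by rewrite nc0.
by apply: le_trans (ncD _ _) _; rewrite lerD2l.
Qed.
Lemma nc_eq0 w : nc w <= 0 -> w = 0.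
Proof.
by move=> w0; apply: ceqP; apply/eqP; rewrite -normr_le0 (le_trans _ w0)// ?ncRe ?ncIm.
Qed.

Lemma norm_ge_neq0 (e : R) w : 0 < e -> e%:C%C <= `|w| -> w != 0.
Proof. by move=> e0 ew; rewrite -normr_gt0 (lt_le_trans _ ew)// ltcR. Qed.

(** Real and imaginary parts of the inverse are each at most 1 / e in absolute value, which gives
    the 2. This is the source of every 2 / delta below. *)
Lemma nc_inv (e : R) w : 0 < e -> e%:C%C <= `|w| -> nc w^-1 <= 2 / e.
Proof.
case: w => x y e0; rewrite normc_def /= lecR => ew.
set s := Num.sqrt _ in ew; have s0 : 0 < s by exact: lt_le_trans ew.
have ss : s ^+ 2 = x ^+ 2 + y ^+ 2 by rewrite sqr_sqrtr// addr_ge0// sqr_ge0.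
have xs : `|x| <= s by rewrite -sqrtr_sqr ler_wsqrtr// lerDl sqr_ge0.
have ys : `|y| <= s by rewrite -sqrtr_sqr ler_wsqrtr// lerDr sqr_ge0.
rewrite /nc /= -ss normrN !normrM normrV ?unitfE ?expf_neq0 ?gt_eqF//.
rewrite [`|s ^+ 2|]ger0_norm ?sqr_ge0// -mulrDl.
rewrite ler_pdivrMr ?exprn_gt0// mulrAC ler_pdivlMr//.
apply: (@le_trans _ _ ((s + s) * e)); first by rewrite ler_pM2r// lerD.
rewrite expr2 -mulr2n -mulr_natl -!mulrA; nra.
Qed.

Definition cto u w := (Re (u n) @[n --> \oo] --> Re w) /\ (Im (u n) @[n --> \oo] --> Im w).

Lemma ctoD u v a b : cto u a -> cto v b -> cto (fun n => u n + v n) (a + b).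
Proof.
move=> [ur ui] [vr vi]; split.
  by under eq_fun do rewrite cReD; rewrite cReD; exact: cvgD.
by under eq_fun do rewrite cImD; rewrite cImD; exact: cvgD.
Qed.

Lemma ctoM u a c : cto u a -> cto (fun n => c * u n) (c * a).
Proof.
move=> [ur ui]; split.
  by under eq_fun do rewrite cReM; rewrite cReM; apply: cvgB; exact: cvgMr.
by under eq_fun do rewrite cImM; rewrite cImM; apply: cvgD; exact: cvgMr.
Qed.

Lemma ctoN u a : cto u a -> cto (fun n => - u n) (- a).
Proof.
by move=> /(ctoM (-1)); rewrite mulN1r; under eq_fun do rewrite mulN1r.
Qed.

Lemma cto_le u w (b : nat -> R) B : cto u w -> b @ \oo --> B ->
  (forall n, nc (u n) <= b n) -> nc w <= B.
Proof.
move=> [ur ui] bB ub; have cu : nc (u n) @[n --> \oo] --> nc w by apply: cvgD; exact: cvg_norm.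
by apply: (ler_cvg_to cu bB); exact: nearW.
Qed.

Lemma cto_squeeze u w (e : nat -> R) : e @ \oo --> 0 ->
  (forall n, nc (u n - w) <= e n) -> cto u w.
Proof.
move=> e0 ue.
have key (f : R[i] -> R) : (forall a b, f (a - b) = f a - f b) ->
    (forall a, `|f a| <= nc a) -> f (u n) @[n --> \oo] --> f w.
  move=> fB fn.
  have c1 : f w - e n @[n --> \oo] --> f w.
    by rewrite -[X in _ --> X]subr0; apply: cvgB => //; exact: cvg_cst.
  have c2 : f w + e n @[n --> \oo] --> f w.
    by rewrite -[X in _ --> X]addr0; apply: cvgD => //; exact: cvg_cst.
  apply: (squeeze_cvgr _ c1 c2); apply: nearW => n.
  by rewrite -ler_distl -fB; exact: le_trans (fn _) (ue n).
by split; apply: key => *; rewrite ?cReD ?cReN ?cImD ?cImN ?ncRe ?ncIm.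
Qed.

Lemma cto_csum u : ccvg_series u -> cto (fun n => \sum_(k < n) u k) (csum u).
Proof.
move=> [ur ui]; split.
  under eq_fun do rewrite cRe_sum -(big_mkord xpredT (fun k => Re (u k))); exact: ur.
under eq_fun do rewrite cIm_sum -(big_mkord xpredT (fun k => Im (u k))); exact: ui.
Qed.

Lemma csumP u w : cto (fun n => \sum_(k < n) u k) w -> ccvg_series u /\ csum u = w.
Proof.
move=> [wr wi].
have r : series (fun n => Re (u n)) @ \oo --> Re w.
  by move: wr; under eq_fun do rewrite cRe_sum -(big_mkord xpredT (fun k => Re (u k))).
have i : series (fun n => Im (u n)) @ \oo --> Im w.
  by move: wi; under eq_fun do rewrite cIm_sum -(big_mkord xpredT (fun k => Im (u k))).
split; first by split; apply/cvg_ex; eexists; eassumption.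
by apply: ceqP => /=; apply/cvg_lim.
Qed.

(** * Majorant criterion for complex series *)

Section Majorant.
Variables (u : nat -> R[i]) (b : nat -> R).
Hypotheses (ub : forall n, nc (u n) <= b n) (cb : cvgn (series b)).

Lemma ccvg_majorant : ccvg_series u.
Proof.
have key (f : R[i] -> R) : (forall a, `|f a| <= nc a) -> cvgn (series (fun n => f (u n))).
  move=> fn; apply: normed_cvg; apply: (series_le_cvg (v_ := b)) => [n|n|n|//] /=.
  - exact: normr_ge0.
  - exact: le_trans (nc_ge0 (u n)) (ub n).
  - exact: le_trans (fn _) (ub n).
by split; apply: key; [exact: ncRe|exact: ncIm].
Qed.

Lemma nc_csum : nc (csum u) <= limn (series b).
Proof.
apply: (cto_le (cto_csum ccvg_majorant) cb) => n.
by rewrite /series /= big_mkord; apply: le_trans (nc_sum _ _) _; exact: ler_sum.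
Qed.

Lemma nc_csum_tail n : nc (csum u - \sum_(k < n) u k) <= limn (series b) - series b n.
Proof.
have h := ctoD (cto_csum ccvg_majorant) (u := fun m => \sum_(k < m) u k)
  (v := fun=> - \sum_(k < n) u k) (b := - \sum_(k < n) u k).
have {}h : cto (fun m => \sum_(k < m + n) u k - \sum_(k < n) u k) (csum u - \sum_(k < n) u k).
  have [hr hi] := h (conj (cvg_cst _) (cvg_cst _)).
  by split; [rewrite -(cvg_shiftn n) in hr | rewrite -(cvg_shiftn n) in hi].
have cb' : series b (m + n)%N - series b n @[m --> \oo] --> limn (series b) - series b n.
  by apply: cvgB; [rewrite cvg_shiftn|exact: cvg_cst].
apply: (cto_le h cb') => m.
rewrite addnC -!(big_mkord xpredT u) (big_cat_nat (leq0n n) (leq_addr m n)) /=.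
rewrite addrAC subrr add0r /series /= (big_cat_nat (leq0n n) (leq_addr m n)) /=.
rewrite addrAC subrr add0r; apply: le_trans (nc_sum _ _) _; exact: ler_sum.
Qed.

End Majorant.
End ComplexSeries.

(** * Complex exponential and integrals *)

Section ComplexExponential.
Context (R : realType).
Implicit Types (x y : R) (w : R[i]).

Lemma norm_sin_le y : `|sin y| <= `|y|.
Proof.
wlog y0 : y / 0 <= y => [h|].
  have [/h //|/ltW] := leP 0 y; rewrite -oppr_ge0 => /h.
  by rewrite sinN !normrN.
have cs : {within `[0, y], continuous sin}.
  by apply: continuous_subspaceT; exact: continuous_sin.
have [c _] := MVT_segment y0 (fun x _ => is_derive_sin x) cs.
rewrite sin0 !subr0 => ->; rewrite normrM ler_piMl//; exact: cos_max.
Qed.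

(** The mean value theorem gives - sin c * y with 0 < c < y; bounding |sin c| by 1 or by c yields
    the two estimates. The linear one feeds [norm_sinB_le]. *)
Lemma norm_cosB1_le y : `|cos y - 1| <= `|y| /\ `|cos y - 1| <= `|y| ^+ 2.
Proof.
wlog y0 : y / 0 <= y => [h|].
  have [/h //|/ltW] := leP 0 y; rewrite -oppr_ge0 => /h.
  by rewrite cosN !normrN.
have cs : {within `[0, y], continuous cos}.
  by apply: continuous_subspaceT; exact: continuous_cos.
have [c] := MVT_segment y0 (fun x _ => is_derive_cos x) cs.
rewrite in_itv /= cos0 subr0 => /andP[c0 cy] ->; rewrite normrM normrN; split.
  by rewrite ler_piMl//; exact: sin_max.
rewrite expr2 ler_wpM2r//; apply: le_trans (norm_sin_le _) _.
by rewrite !ger0_norm.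
Qed.

Lemma norm_sinB_le y : `|sin y - y| <= `|y| ^+ 2.
Proof.
wlog y0 : y / 0 <= y => [h|].
  have [/h //|/ltW] := leP 0 y; rewrite -oppr_ge0 => /h.
  by rewrite sinN -opprD !normrN.
have cs : {within `[0, y], continuous (fun x => sin x - x)}.
  apply: continuous_subspaceT => x.
  by apply: cvgB; [exact: continuous_sin|exact: cvg_id].
have ds (x : R) : x \in `]0, y[ -> is_derive x 1 (fun x => sin x - x) (cos x - 1).
  by move=> _; apply: is_deriveB.
have [c] := MVT_segment y0 ds cs.
rewrite in_itv /= sin0 !subr0 => /andP[c0 cy] ->; rewrite normrM expr2 ler_wpM2r//.
by apply: le_trans (norm_cosB1_le _).1 _; rewrite !ger0_norm.
Qed.

Lemma norm_expRB1_le x : `|expR x - 1| <= `|x| * expR `|x|.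
Proof.
have h1 := expR_ge1Dx x; have h2 := expR_ge1Dx (- x).
have e : expR x * expR (- x) = 1 by rewrite -expRD subrr expR0.
have e0 := expR_gt0 x; have e1 := expR_gt0 `|x|.
have [x0|x0] := leP 0 x.
  by rewrite (ger0_norm x0) ger0_norm; nra.
have : 1 <= expR `|x| by rewrite -[leLHS]expR0 ler_expR.
rewrite ltr0_norm// => ?; rewrite ltr0_norm; first by nra.
by rewrite subr_lt0 -[ltRHS]expR0 ltr_expR.
Qed.

(** Multiplying 1 - x <= exp(-x) by exp x gives exp x - 1 <= x exp x, hence 0 <= exp x - 1 - x <= x
    (exp x - 1) for either sign of x. *)
Lemma norm_expRB1x_le x : `|expR x - 1 - x| <= `|x| ^+ 2 * expR `|x|.
Proof.
have h1 := expR_ge1Dx x; have h2 := expR_ge1Dx (- x).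
have e : expR x * expR (- x) = 1 by rewrite -expRD subrr expR0.
have e0 := expR_gt0 x.
rewrite ger0_norm; last by lra.
apply: (@le_trans _ _ (`|x| * `|expR x - 1|)); last first.
  by rewrite expr2 -mulrA ler_wpM2l// norm_expRB1_le.
by rewrite -normrM; apply: le_trans (ler_norm _); nra.
Qed.

Lemma cexpD (a b : R[i]) : cexp (a + b) = cexp a * cexp b.
Proof.
apply: ceqP; rewrite ?cReM ?cImM /= cReD cImD expRD ?cosD ?sinD; ring.
Qed.

Lemma cexp0 : cexp 0 = 1 :> R[i].
Proof. by rewrite /cexp /= expR0 cos0 sin0 mulr1 mulr0. Qed.

Lemma nc_cexp w : nc (cexp w) <= 2 * expR (nc w).
Proof.
rewrite /nc /= !normrM !(ger0_norm (expR_ge0 _)).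
have le : expR (complex.Re w) <= expR (nc w).
  by rewrite ler_expR (le_trans (ler_norm _))// ncRe.
have := cos_max (complex.Im w); have := sin_max (complex.Im w).
rewrite -/(nc w); have := expR_gt0 (complex.Re w); have := normr_ge0 (cos (complex.Im w)).
have := normr_ge0 (sin (complex.Im w)); nra.
Qed.

(** Real and imaginary parts of the remainder are each written as two terms, every one at most expR
    K * s ^+ 2; hence the constant 4. *)
Lemma nc_cexpB1w w K : nc w <= K -> nc (cexp w - 1 - w) <= 4 * expR K * nc w ^+ 2.
Proof.
case: w => x y; set s := nc _ => sK.
have xs : `|x| <= s by exact: (ncRe (Complex x y)).
have ys : `|y| <= s by exact: (ncIm (Complex x y)).
have K0 : 0 <= K by exact: le_trans (nc_ge0 _) sK.
have eK : expR `|x| <= expR K by rewrite ler_expR (le_trans xs).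
have eK1 : 1 + `|x| <= expR K.
  by apply: le_trans (expR_ge1Dx `|x|) _.
have e1 : 1 <= expR K by rewrite -[leLHS]expR0 ler_expR.
have x0 := normr_ge0 x; have y0 := normr_ge0 y.
have -> : nc (cexp (Complex x y) - 1 - Complex x y) =
    `|(expR x - 1 - x) * cos y + (1 + x) * (cos y - 1)| +
    `|(expR x - 1) * sin y + (sin y - y)|.
  rewrite /nc !cReD !cImD !cReN !cImN /=; by congr (_ + _); congr (`|_|); ring.
have [_ c2] := norm_cosB1_le y.
have b1 : `|(expR x - 1 - x) * cos y| <= expR K * s ^+ 2.
  rewrite normrM; apply: (@le_trans _ _ (`|x| ^+ 2 * expR `|x| * 1)).
    by rewrite ler_pM// ?cos_max// norm_expRB1x_le.
  by rewrite mulr1 mulrC ler_pM ?expR_ge0 ?exprn_ge0// lerXn2r// nnegrE (le_trans x0).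
have b2 : `|(1 + x) * (cos y - 1)| <= expR K * s ^+ 2.
  rewrite normrM ler_pM//; first by apply: le_trans (ler_normD _ _) _; rewrite normr1.
  by apply: le_trans c2 _; rewrite lerXn2r// nnegrE (le_trans y0).
have b3 : `|(expR x - 1) * sin y| <= expR K * s ^+ 2.
  rewrite normrM; apply: (@le_trans _ _ (`|x| * expR `|x| * `|y|)).
    by rewrite ler_pM// ?norm_sin_le// norm_expRB1_le.
  rewrite mulrAC mulrC ler_pM ?expR_ge0 ?mulr_ge0// expr2 ler_pM//.
have b4 : `|sin y - y| <= expR K * s ^+ 2.
  apply: le_trans (norm_sinB_le y) _.
  rewrite -[leLHS]mul1r ler_pM ?exprn_ge0// lerXn2r// nnegrE (le_trans y0)//.
apply: le_trans (lerD (ler_normD _ _) (ler_normD _ _)) _; lra.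
Qed.

(** The factor 2 ^+ n in [key] is the gain after n bisections; as n grows it rules out any nonzero
    increment. *)
Lemma quadratic_constant (m : R -> R) (h : R -> R[i]) (C : R) :
  continuous m -> 0 <= C -> {homo m : s t / s <= t} ->
  (forall s t, 0 <= s -> s <= t -> nc (h t - h s) <= C * (m t - m s) ^+ 2) ->
  forall t, 0 <= t -> h t = h 0.
Proof.
move=> cm C0 md hC.
have key n : forall s t, 0 <= s -> s <= t ->
    2 ^+ n * nc (h t - h s) <= C * (m t - m s) ^+ 2.
  elim: n => [|n IH] s t s0 st; first by rewrite expr0 mul1r hC.
  have mst := md _ _ st.
  (* At [u] the function [m] takes its mean value. The quadratic bounds on the two pieces add up to
     half the original one, which pays for one more factor 2. *)
  have [||u] := @IVT R m s t ((m s + m t) / 2) st.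
  - by apply: continuous_subspaceT => x; exact: cm.
  - by rewrite min_l// max_r//; apply/andP; split; lra.
  rewrite in_itv /= => /andP[su ut] mu.
  have := IH _ _ s0 su; have := IH _ _ (le_trans s0 su) ut; rewrite mu => h1 h2.
  have tri : nc (h t - h s) <= nc (h t - h u) + nc (h u - h s).
    by rewrite -[X in nc X](subrKA (h u)) ncD.
  have p0 : 0 < 2 ^+ n :> R by exact: exprn_gt0.
  rewrite exprS; nra.
move=> t t0; apply/eqP; rewrite -subr_eq0; apply/eqP/nc_eq0.
rewrite leNgt; apply/negP => p.
set K := C * (m t - m 0) ^+ 2.
have K0 : 0 <= K / nc (h t - h 0) by apply: divr_ge0; [rewrite mulr_ge0 ?sqr_ge0|exact: ltW].
have := archi_boundP K0; set n := Num.bound _ => nK.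
have := key n _ _ (lexx 0) t0; rewrite -/K -ler_pdivlMr//; apply/negP.
rewrite -ltNge (lt_trans nK)// -natrX ltr_nat; exact: ltn_expl.
Qed.

End ComplexExponential.

(** * Measurability and integration of complex functions *)

Section ComplexIntegral.
Context (R : realType) (d' : measure_display) (T : measurableType d').
Implicit Types (f g : T -> R[i]).
Local Notation Re := complex.Re.
Local Notation Im := complex.Im.

Definition cmeas f := measurable_fun setT (fun x => Re (f x)) /\
                      measurable_fun setT (fun x => Im (f x)).

Lemma cmeas_cst c : cmeas (fun=> c). Proof. by split. Qed.

Lemma cmeasD f g : cmeas f -> cmeas g -> cmeas (fun x => f x + g x).
Proof.
move=> [fr fi] [gr gi]; split.
  by under eq_fun do rewrite cReD; exact: measurable_funD.
by under eq_fun do rewrite cImD; exact: measurable_funD.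
Qed.

Lemma cmeasM f g : cmeas f -> cmeas g -> cmeas (fun x => f x * g x).
Proof.
move=> [fr fi] [gr gi]; split.
  by under eq_fun do rewrite cReM; apply: measurable_funB; exact: measurable_funM.
by under eq_fun do rewrite cImM; apply: measurable_funD; exact: measurable_funM.
Qed.

Lemma cmeas_real (f : T -> R) : measurable_fun setT f -> cmeas (fun x => (f x)%:C%C).
Proof. by move=> mf; split. Qed.

Lemma cmeas_sum n (f : nat -> T -> R[i]) : (forall k, cmeas (f k)) ->
  cmeas (fun x => \sum_(k < n) f k x).
Proof.
move=> mf; elim: n => [|n IH]; first by under eq_fun do rewrite big_ord0; exact: cmeas_cst.
by under eq_fun do rewrite big_ord_recr; exact: cmeasD.
Qed.

Lemma cmeas_cto (f : nat -> T -> R[i]) g : (forall n, cmeas (f n)) ->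
  (forall x, cto (f ^~ x) (g x)) -> cmeas g.
Proof.
move=> mf fg; split.
  apply: (measurable_fun_cvg (h := fun n x => Re (f n x))) => [n|x _].
    by case: (mf n).
  by case: (fg x).
apply: (measurable_fun_cvg (h := fun n x => Im (f n x))) => [n|x _].
  by case: (mf n).
by case: (fg x).
Qed.

Lemma cmeas_inv f : cmeas f -> (forall x, f x != 0) -> cmeas (fun x => (f x)^-1).
Proof.
move=> [fr fi] f0.
pose s x := Re (f x) ^+ 2 + Im (f x) ^+ 2.
have s0 x : 0 < s x.
  rewrite lt_neqAle addr_ge0 ?sqr_ge0// andbT eq_sym; apply: contra (f0 x).
  rewrite /s paddr_eq0 ?sqr_ge0// !sqrf_eq0 => /andP[/eqP r0 /eqP i0].
  by apply/eqP/ceqP.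
have ms : measurable_fun setT (fun x => (s x)^-1).
  have m1 : measurable_fun setT s by apply: measurable_funD; exact: measurable_funX.
  have m2 : measurable_fun setT (fun x => 0 - ln (s x)).
    by apply: measurable_funB => //; exact: (measurableT_comp (@measurable_ln R) m1).
  (* Writing 1 / s as exp(- ln s) reduces the claim to measurability of exp and ln. *)
  rewrite (_ : (fun _ => _) = fun x => expR (0 - ln (s x))).
    exact: (measurableT_comp (@measurable_expR R) m2).
  by apply/funext => x; rewrite sub0r expRN lnK// posrE.
split.
  rewrite (_ : (fun _ => _) = fun x => Re (f x) * (s x)^-1); first exact: measurable_funM.
  by apply/funext => x; rewrite /s; case: (f x).
rewrite (_ : (fun _ => _) = fun x => - (Im (f x) * (s x)^-1)).
  by apply: measurableT_comp => //; exact: measurable_funM.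
by apply/funext => x; rewrite /s; case: (f x).
Qed.

Variable mu : {finite_measure set T -> \bar R}.

Definition cI f : R[i] := Complex (fine (\int[mu]_x (Re (f x))%:E)%E)
                                  (fine (\int[mu]_x (Im (f x))%:E)%E).

Definition cbounded f := exists C, forall x, nc (f x) <= C.

Lemma bounded_integrable (f : T -> R) (C : R) : measurable_fun setT f ->
  (forall x, `|f x| <= C) -> mu.-integrable setT (EFin \o f).
Proof.
move=> mf fC; apply: measurable_bounded_integrable => //.
  by rewrite -ge0_fin_numE// fin_num_measure.
exists C; split; first exact: num_real.
by move=> y Cy x _; exact: le_trans (fC x) (ltW Cy).
Qed.

Lemma cbounded_integrable f : cmeas f -> cbounded f ->
  mu.-integrable setT (EFin \o (fun x => Re (f x))) /\
  mu.-integrable setT (EFin \o (fun x => Im (f x))).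
Proof.
move=> [fr fi] [C fC]; split; apply: (bounded_integrable (C := C)) => // x.
  exact: le_trans (ncRe _) (fC x).
exact: le_trans (ncIm _) (fC x).
Qed.

Lemma cID f g : cmeas f -> cbounded f -> cmeas g -> cbounded g ->
  cI (fun x => f x + g x) = cI f + cI g.
Proof.
move=> mf bf mg bg; have [f1 f2] := cbounded_integrable mf bf.
have [g1 g2] := cbounded_integrable mg bg.
apply: ceqP; rewrite ?cReD ?cImD /=.
  by under eq_integral do rewrite cReD; exact: (RintegralD measurableT f1 g1).
by under eq_integral do rewrite cImD; exact: (RintegralD measurableT f2 g2).
Qed.

Lemma cIZ c f : cmeas f -> cbounded f -> cI (fun x => c * f x) = c * cI f.
Proof.
move=> mf bf; have [f1 f2] := cbounded_integrable mf bf.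
have h (a : R) (g : T -> R) : mu.-integrable setT (EFin \o g) ->
    mu.-integrable setT (EFin \o (fun x => a * g x)).
  by move=> ig; exact: (integrableZl measurableT a ig).
apply: ceqP; rewrite ?cReM ?cImM /=.
  under eq_integral do rewrite cReM.
  apply: etrans (RintegralB measurableT (h (Re c) _ f1) (h (Im c) _ f2)) _.
  by congr (_ - _); [exact: (RintegralZl _ measurableT f1)|
                     exact: (RintegralZl _ measurableT f2)].
under eq_integral do rewrite cImM.
apply: etrans (RintegralD measurableT (h (Re c) _ f2) (h (Im c) _ f1)) _.
by congr (_ + _); [exact: (RintegralZl _ measurableT f2)|
                   exact: (RintegralZl _ measurableT f1)].
Qed.

Lemma cbounded_sum n (F : nat -> T -> R[i]) : (forall k, cbounded (F k)) ->
  cbounded (fun x => \sum_(k < n) F k x).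
Proof.
move=> bF; elim: n => [|n [C IH]].
  by exists 0 => x; rewrite big_ord0 nc0.
have [C' h] := bF n; exists (C + C') => x; rewrite big_ord_recr /=.
by apply: le_trans (ncD _ _) _; exact: lerD.
Qed.

Lemma cI_sum n (F : nat -> T -> R[i]) : (forall k, cmeas (F k)) ->
  (forall k, cbounded (F k)) ->
  cI (fun x => \sum_(k < n) F k x) = \sum_(k < n) cI (F k).
Proof.
move=> mF bF; elim: n => [|n IH].
  rewrite big_ord0; under eq_fun do rewrite big_ord0.
  by apply: ceqP; rewrite /cI /= integral0.
rewrite big_ord_recr /= -IH -cID//; [|exact: cmeas_sum|exact: cbounded_sum].
by congr cI; apply/funext => x; rewrite big_ord_recr.
Qed.

(** With the l1 norm the estimate splits into real and imaginary parts and loses no constant. *)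
Lemma nc_cI f (A : set T) (C : R) : cmeas f -> measurable A -> 0 <= C ->
  (forall x, nc (f x) <= C * \1_A x) -> nc (cI f) <= C * fine (mu A).
Proof.
move=> mf mA C0 fA.
have fC x : nc (f x) <= C.
  by apply: le_trans (fA x) _; rewrite ler_piMr// indicE; case: (_ \in _).
have bf : cbounded f by exists C.
have [f1 f2] := cbounded_integrable mf bf.
have n1 := integrable_norm f1; have n2 := integrable_norm f2.
apply: (@le_trans _ _ (\int[mu]_x (`|Re (f x)| + `|Im (f x)|))).
  rewrite RintegralD//; apply: lerD; exact: le_normr_Rintegral.
apply: (@le_trans _ _ (\int[mu]_x (C * \1_A x))).
  apply: le_Rintegral => //.
  - by apply: (integrableD measurableT n1 n2).
  - exact: (integrableZl measurableT C (integrable_indic mu mA)).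
  - by move=> x _; exact: fA.
rewrite RintegralZl//; last exact: integrable_indic.
by rewrite /Rintegral integral_indic// setIT.
Qed.

End ComplexIntegral.

(** * Tails, distribution functions, exponential increments *)

Section ExponentialTail.
Context (R : realType).

(** Partial sums of a Cauchy product fill the triangle j + m < n, so the inner sums are cut at n -
    j. *)
Lemma triangle_sum (V : nmodType) (F : nat -> nat -> V) n :
  \sum_(k < n) \sum_(j < k.+1) F j (k - j)%N = \sum_(j < n) \sum_(m < n - j) F j m.
Proof.
elim: n => [|n IH]; first by rewrite !big_ord0.
rewrite big_ord_recr /= IH [in RHS]big_ord_recr /= subSnn big_ord1.
rewrite [X in _ + X]big_ord_recr /= subnn addrA; congr (_ + _).
rewrite -big_split /=; apply: eq_bigr => j _.
by rewrite subSn ?(ltnW (ltn_ord j))// big_ord_recr.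
Qed.

Lemma exp_coeff_conv (q : R) k :
  \sum_(j < k.+1) exp_coeff q j * exp_coeff q (k - j)%N = exp_coeff (q + q) k.
Proof.
rewrite /exp_coeff /= exprDn mulr_suml; apply: eq_bigr => j _.
have jk : (j <= k)%N by rewrite -ltnS.
have := bin_fact jk => /(congr1 (fun n => n%:R : R)); rewrite !natrM => <-.
have n0 (n : nat) : n`!%:R != 0 :> R by rewrite pnatr_eq0 -lt0n fact_gt0.
rewrite -mulr_natr; field.
by rewrite !n0 pnatr_eq0 -lt0n bin_gt0 jk.
Qed.

Lemma series_exp_coeff (q : R) : series (exp_coeff q) @ \oo --> expR q.
Proof. exact: is_cvg_series_exp_coeff. Qed.

Definition exp_tail (q : R) n := expR q - series (exp_coeff q) n.

(** By convolution of coefficients the sum equals e^q S_n(q) - S_n(2q), with S_n the partial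
    exponential sums, and both terms tend to e^(2q). It controls completing the inner series of a
    Cauchy product. *)
Lemma exp_tail_cvg (q : R) :
  \sum_(j < n) exp_coeff q j * exp_tail q (n - j) @[n --> \oo] --> 0.
Proof.
have -> : (fun n => \sum_(j < n) exp_coeff q j * exp_tail q (n - j)) =
    (fun n => expR q * series (exp_coeff q) n - series (exp_coeff (q + q)) n).
  apply/funext => n; rewrite /exp_tail; under eq_bigr do rewrite mulrBr.
  rewrite sumrB -mulr_suml mulrC; congr (_ * _ - _).
    by rewrite /series /= big_mkord.
  rewrite /series /= big_mkord; under [RHS]eq_bigr do rewrite -exp_coeff_conv.
  rewrite (triangle_sum (fun j m => exp_coeff q j * exp_coeff q m)).
  by apply: eq_bigr => j _; rewrite big_mkord mulr_sumr.
rewrite -(subrr (expR (q + q))) {1}expRD.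
by apply: cvgB; [apply: cvgMr|]; exact: series_exp_coeff.
Qed.

End ExponentialTail.

(** * Power series in the activity dominated by the exponential series *)

Section PowerSeriesBound.
Context (R : realType) (lam : R[i]) (L : R).
Hypothesis L0 : 0 <= L.

Definition cf k : R[i] := lam ^+ k / (k`!)%:R.
Let q := nc lam * L.

Lemma natVC n : (n%:R : R[i])^-1 = (n%:R^-1 : R)%:C%C.
Proof. by rewrite fmorphV rmorph_nat. Qed.

Lemma nc_cf k : nc (cf k) <= nc lam ^+ k / k`!%:R.
Proof.
rewrite /cf natVC mulrC nc_realM ?invr_ge0// mulrC ler_wpM2r ?invr_ge0//.
exact: ncX.
Qed.

Lemma nc_cfL k : nc (cf k) * L ^+ k <= exp_coeff q k.
Proof.
rewrite /exp_coeff /= /q exprMn mulrAC ler_wpM2r ?exprn_ge0//; exact: nc_cf.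
Qed.

(** The number of splits of k points turns one factor 1/k! into the two factorials of a Cauchy
    product. *)
Lemma cf_binom k j : (j <= k)%N -> cf k * 'C(k, j)%:R = cf j * cf (k - j).
Proof.
move=> jk; rewrite /cf; have := bin_fact jk => /(congr1 (fun n => n%:R : R[i])).
rewrite !natrM => <-.
have n0 (n : nat) : n`!%:R != 0 :> R[i] by rewrite pnatr_eq0 -lt0n fact_gt0.
have b0 : 'C(k, j)%:R != 0 :> R[i] by rewrite pnatr_eq0 -lt0n bin_gt0.
rewrite -{1}(subnKC jk) exprD; field.
by rewrite !n0 b0.
Qed.

Variable Zs : nat -> R.
Hypothesis Zs_itv : forall k, 0 <= Zs k <= L ^+ k.

Let zb k : nc (cf k * (Zs k)%:C%C) <= exp_coeff q k.
Proof.
have /andP[z0 z1] := Zs_itv k.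
rewrite mulrC nc_realM// mulrC; apply: le_trans (nc_cfL k).
by rewrite ler_wpM2l// nc_ge0.
Qed.

Let cq : cvgn (series (exp_coeff q)).
Proof. exact: is_cvg_series_exp_coeff. Qed.

Lemma ccvg_cf : ccvg_series (fun k => cf k * (Zs k)%:C%C).
Proof. exact: ccvg_majorant zb cq. Qed.

Lemma nc_csum_cf : nc (csum (fun k => cf k * (Zs k)%:C%C)) <= expR q.
Proof. exact: nc_csum zb cq. Qed.

Lemma nc_csum_cf_tail n :
  nc (csum (fun k => cf k * (Zs k)%:C%C) - \sum_(k < n) cf k * (Zs k)%:C%C) <= exp_tail q n.
Proof. exact: (nc_csum_tail zb cq). Qed.

End PowerSeriesBound.

(** * Distribution function of an atomless finite measure *)

Section AtomlessDistribution.
Context (R : realType) (rho : {measure set R -> \bar R}).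
Hypothesis rho_fin : forall S, measurable S -> rho S \is a fin_num.

(** Strict as in [ppin], so that differences of [distr] are masses of half-open intervals [s, t);
    [t] is extended real because full pinning is t = +oo. *)
Definition below (t : \bar R) := [set r : R | (r%:E < t)%E].
Definition distr t := fine (rho (below t)).

Lemma mbelow t : measurable (below t).
Proof.
have h : measurable_fun setT (fun r : R => (r%:E < t)%E).
  by apply: measurable_fun_lte => //; exact/measurable_EFinP.
by have := h measurableT [set true]; rewrite setTI; exact.
Qed.

Let mb t : measurable (below t). Proof. exact: mbelow. Qed.

Lemma distr_le s t : (s <= t)%E -> distr s <= distr t.
Proof.
move=> st; apply: fine_le; rewrite ?rho_fin//.
by apply: le_measure; [exact/mem_set|exact/mem_set|move=> r /= /lt_le_trans; exact].
Qed.

Lemma distr_diff_le s t (S : set R) : (s <= t)%E -> measurable S ->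
  [set r : R | (s <= r%:E < t)%E] `<=` S -> distr t - distr s <= fine (rho S).
Proof.
move=> st mS sS; rewrite lerBlDl /distr -fineD ?rho_fin//; apply: fine_le.
- exact: rho_fin.
- by rewrite fin_numD !rho_fin.
apply: (@le_trans _ _ (rho (below s `|` S))); last exact: measureU2.
apply: le_measure; [exact/mem_set|exact/mem_set/measurableU|].
move=> r /= rt; case: (ltP r%:E s) => rs; first by left.
by right; apply: sS; rewrite /= rs rt.
Qed.

Hypothesis atom : forall c, rho [set c] = 0%E.

(** The masses of the intervals of radius 1/(n+1) around r decrease to that of {r}, which is 0, and
    they dominate the increments near r. *)
Lemma distr_continuous : continuous (fun r : R => distr r%:E).
Proof.
move=> r; apply/cvgrPdist_le => e e0.
pose F n : set R := `]r - n.+1%:R^-1, r + n.+1%:R^-1[%classic.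
have mF n : measurable (F n) by exact: measurable_itv.
have capF : \bigcap_n F n = [set r].
  apply/seteqP; split => [x Fx|x -> n _]; last first.
    rewrite /F /= in_itv /=; apply/andP; split.
      by rewrite ltrBlDr ltrDl invr_gt0.
    by rewrite ltrDl invr_gt0.
  apply/eqP; rewrite -subr_eq0 -normr_le0; apply/ler_addgt0Pl => a a0; rewrite addr0.
  have [n na] : exists n : nat, n.+1%:R^-1 < a.
    exists (Num.bound a^-1); rewrite invf_plt ?posrE// (lt_trans (archi_boundP _))//.
      by rewrite invr_ge0 ltW.
    by rewrite ltr_nat.
  have := Fx n I; rewrite /F /= in_itv /= => /andP[x1 x2].
  move: x1 x2 na; set b := n.+1%:R^-1 => x1 x2 na.
  by rewrite ler_norml; apply/andP; split; lra.
have cF : rho (F n) @[n --> \oo] --> 0%E.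
  rewrite -(atom r) -capF; apply: nonincreasing_cvg_mu => //.
  - by rewrite -ge0_fin_numE// rho_fin.
  - by rewrite capF.
  - apply/nonincreasing_seqP => n; apply/subsetPset => x; rewrite /F /= !in_itv /=.
    have : n.+2%:R^-1 <= n.+1%:R^-1 :> R by rewrite lef_pV2 ?posrE// ler_nat.
    set b := n.+1%:R^-1; set b' := n.+2%:R^-1 => nn /andP[x1 x2].
    by apply/andP; split; lra.
have {}cF : fine (rho (F n)) @[n --> \oo] --> (0 : R) by apply: fine_cvg.
have [n _ nF] : \forall n \near \oo, `|0 - fine (rho (F n))| <= e.
  by move/cvgrPdist_le: cF; apply.
have {nF} := nF n (leqnn n); rewrite sub0r normrN ger0_norm ?fine_ge0// => nF.
apply/nbhs_ballP; exists n.+1%:R^-1; first by rewrite /= invr_gt0.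
have n0 : 0 < n.+1%:R^-1 :> R by rewrite invr_gt0.
move=> x /=; rewrite ltr_norml; move: n0 nF; rewrite /F.
set b := n.+1%:R^-1 => n0 nF /andP[b1 b2].
apply: le_trans nF; case: (leP x r) => xr.
  have xr' : (x%:E <= r%:E)%E by rewrite lee_fin.
  rewrite ger0_norm ?subr_ge0 ?distr_le//; apply: distr_diff_le => // u /=.
  rewrite lee_fin lte_fin in_itv /= => /andP[u1 u2].
  by apply/andP; split; lra.
have xr' : (r%:E <= x%:E)%E by rewrite lee_fin ltW.
rewrite distrC ger0_norm ?subr_ge0 ?distr_le//; apply: distr_diff_le => // u /=.
rewrite lee_fin lte_fin in_itv /= => /andP[u1 u2].
by apply/andP; split; lra.
Qed.

Lemma distr_cvg_pinfty : distr (n%:R)%:E @[n --> \oo] --> distr +oo%E.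
Proof.
apply: fine_cvg; rewrite fineK; last exact: rho_fin.
have -> : below +oo%E = \bigcup_n below (n%:R)%:E.
  apply/seteqP; split => [x _|x _ /=]; last by rewrite /below /= ltry.
  exists (Num.bound `|x|) => //; rewrite /below /= lte_fin.
  by apply: le_lt_trans (ler_norm x) _; exact: archi_boundP.
apply: nondecreasing_cvg_mu => //; first exact: bigcup_measurable.
apply/nondecreasing_seqP => n; apply/subsetPset => x /=; rewrite /below /=.
by move=> xn; apply: lt_trans xn _; rewrite lte_fin ltr_nat.
Qed.

End AtomlessDistribution.

Section ExponentialStep.
Context (R : realType).

(** An exact identity separates three errors: the remainder of the exponential, the product (ft -
    fs) * m1 of two small quantities, and the first-order defect of [f]. Each is a multiple of x ^+
    2. In use, x is the mass of [s, t) and c is 2 / delta. *)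
Lemma nc_cexp_step (ft fs m0 m1 : R[i]) (E K c x : R) : 0 <= c -> 0 <= x -> 0 <= E ->
  nc ft <= E -> nc m1 <= c * x -> nc m1 <= K -> nc m0 <= K ->
  nc (fs - ft) <= x -> nc (fs - ft - fs * m1) <= c * x ^+ 2 ->
  nc (ft * cexp (m0 + m1) - fs * cexp m0) <=
    2 * expR K * (E * (4 * expR K * c ^+ 2) + c + c) * x ^+ 2.
Proof.
move=> c0 x0 E0 ftE m1c m1K m0K fst first.
have -> : ft * cexp (m0 + m1) - fs * cexp m0 = cexp m0 *
    (ft * (cexp m1 - 1 - m1) + (ft - fs) * m1 - (fs - ft - fs * m1)).
  by rewrite cexpD; ring.
rewrite -mulrA; apply: le_trans (ncM _ _) _.
apply: ler_pM; rewrite ?nc_ge0//.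
  by apply: le_trans (nc_cexp _) _; rewrite ler_pM2l// ler_expR.
apply: le_trans (ncD _ _) _; rewrite ncN [leRHS]mulrDl; apply: lerD; last exact: first.
rewrite [leRHS]mulrDl.
apply: le_trans (ncD _ _) _; apply: lerD.
  apply: le_trans (ncM _ _) _; rewrite -mulrA; apply: ler_pM; rewrite ?nc_ge0//.
  apply: le_trans (nc_cexpB1w m1K) _.
  rewrite -[leRHS]mulrA ler_pM2l; last by rewrite mulr_gt0// expR_gt0.
  by rewrite -exprMn lerXn2r// nnegrE ?nc_ge0// mulr_ge0.
apply: le_trans (ncM _ _) _; rewrite ncBC expr2 mulrCA.
by apply: ler_pM; rewrite ?nc_ge0.
Qed.

Lemma cexp_quotient (lam a b m : R[i]) : a != 0 -> b * cexp m = a * cexp 0 ->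
  lam ^+ 1 * b / a = lam * cexp (- m).
Proof.
move=> a0; rewrite cexp0 mulr1 => e; rewrite expr1 -mulrA; congr (_ * _).
by apply: (mulIf a0); rewrite divfK// -e mulrCA -cexpD addNr cexp0 mulr1.
Qed.

End ExponentialStep.

(** * The interpolation *)

Section Gas.
Context (R : realType) (d : measure_display) (X : measurableType d).
Variables (dist : X -> X -> R) (nu : {measure set X -> \bar R}) (z : X)
  (Lam : set X) (lam : R[i]) (phi : @potential R d X) (y : X) (delta : R).
Hypotheses (dist_ge0 : forall a b, 0 <= dist a b)
  (mdist : measurable_fun setT (dist z))
  (mLam : measurable Lam) (nuLam : (nu Lam < +oo)%E)
  (ac : forall A : set R, measurable A -> (lebesgue_measure A = 0)%E ->
     nuL mLam nuLam (dist z @^-1` A) = 0%E)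
  (sp : pot_symmetric phi) (rp : pot_repulsive phi) (mp : pot_measurable phi)
  (spp : forall t, (0 <= t)%E -> pot_symmetric (ppin dist z phi y t))
  (rpp : forall t, (0 <= t)%E -> pot_repulsive (ppin dist z phi y t))
  (delta0 : 0 < delta)
  (zf : forall t, (0 <= t)%E ->
     delta%:C%C <= `|Defs.partition nu Lam (ppin dist z phi y t) lam|).

Let D := Dz dist z.
Let mu k := pw (nuL mLam nuLam) k.
Let L := fine (nu Lam).
Let q := nc lam * L.
Let psi w := ppinw dist z phi y w.
Let f t := Defs.partition nu Lam (ppin dist z phi y t) lam.
(** The real factor of [main_integrand]; it vanishes on the empty sequence because [pinwt] is 1
    there. *)
Let base w := (1 - pinwt phi y w) * boltz (psi w) w.
Let Zp w m := Zk nu Lam (pin (psi w) w) m.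
Let P w := Defs.partition nu Lam (pin (psi w) w) lam.

Lemma Dz_ge0 w : 0 <= D w.
Proof. by rewrite /D /Dz; apply: sumr_ge0 => i _; exact: dist_ge0. Qed.

Let DE0 w : (0 <= (D w)%:E)%E.
Proof. by rewrite lee_fin Dz_ge0. Qed.

Let rpw w : pot_repulsive (psi w). Proof. exact: rpp. Qed.
Let spw w : pot_symmetric (psi w). Proof. exact: spp. Qed.
Let rpin w : pot_repulsive (pin (psi w) w). Proof. exact: pin_repulsive. Qed.

Let L0 : 0 <= L. Proof. by rewrite /L fine_ge0. Qed.

Let muT k : mu k setT = (L ^+ k)%:E.
Proof. by rewrite /mu pw_setT nuLE setTI. Qed.

Lemma Zk_boltz (chi : @potential R d X) k : pot_repulsive chi ->
  measurable_fun [set: k.-tuple X] (fun w => boltz chi w) ->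
  (Zk nu Lam chi k)%:E = (\int[mu k]_w (boltz chi w)%:E)%E /\
  0 <= Zk nu Lam chi k <= L ^+ k.
Proof.
move=> rc mc; rewrite /Zk.
have -> : (\int[prodm nu (k:=k)]_(w in powset Lam (k:=k)) expeR (- hamiltonian chi w) =
    \int[mu k]_w (boltz chi w)%:E)%E.
  rewrite (_ : (fun w => expeR _) = fun w : k.-tuple X => (boltz chi w)%:E); last first.
    by apply/funext => w; exact: expeR_hamiltonian.
  by rewrite integral_prodm//; exact/measurable_EFinP.
have i0 : (0 <= \int[mu k]_w (boltz chi w)%:E)%E.
  by apply: integral_ge0 => w _; rewrite lee_fin; have /andP[] := boltz_itv w rc.
have i1 : (\int[mu k]_w (boltz chi w)%:E <= (L ^+ k)%:E)%E.
  rewrite -muT -[leRHS]mul1e -(integral_cst (mu k) measurableT 1).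
  apply: ge0_le_integral => //.
  - by move=> w _; rewrite lee_fin; have /andP[] := boltz_itv w rc.
  - exact/measurable_EFinP.
  - by move=> w _; rewrite lee_fin; have /andP[] := boltz_itv w rc.
have fi : (\int[mu k]_w (boltz chi w)%:E \is a fin_num)%E.
  by rewrite ge0_fin_numE// (le_lt_trans i1)// ltry.
split; first by rewrite fineK.
by rewrite fine_ge0//= -lee_fin fineK.
Qed.

Let tval_meas k : seq_meas (fun w : k.-tuple X => tval w).
Proof. exact: seq_meas_tval. Qed.

Let Zt_E t k : (0 <= t)%E -> (Zk nu Lam (ppin dist z phi y t) k)%:E =
  (\int[mu k]_w (boltz (ppin dist z phi y t) w)%:E)%E /\
  0 <= Zk nu Lam (ppin dist z phi y t) k <= L ^+ k.
Proof.
move=> t0; apply: Zk_boltz; first exact: rpp.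
exact: (measurable_boltz_ppin y mdist sp rp mp (r := fun=> t) (measurable_cst _) (tval_meas k)).
Qed.

Let Zp_E w m : (Zp w m)%:E = (\int[mu m]_v (boltz (pin (psi w) w) v)%:E)%E /\
  0 <= Zp w m <= L ^+ m.
Proof.
apply: Zk_boltz; first exact: rpin.
apply: (measurable_boltz_pin mdist sp rp mp (r := fun=> (D w)%:E) (w := fun=> w)).
- by move=> _; exact: rpw.
- exact: measurable_cst.
- exact: seq_meas_cst.
- exact: tval_meas.
Qed.

Lemma partitionE chi : Defs.partition nu Lam chi lam =
  csum (fun k => cf lam k * (Zk nu Lam chi k)%:C%C).
Proof. by []. Qed.

Let base_itv w : 0 <= base w <= 1.
Proof.
have /andP[a0 a1] := pinwt_itv (phi := phi) y rp w.
have /andP[b0 b1] := boltz_itv w (rpw w).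
have h0 : 0 <= 1 - pinwt phi y w by lra.
have h1 : 1 - pinwt phi y w <= 1 by lra.
by rewrite /base mulr_ge0//= mulr_ile1.
Qed.

Let mbase k : measurable_fun setT (fun w : k.-tuple X => base w).
Proof.
apply: measurable_funM; last first.
  apply: (measurable_boltz_ppin y mdist sp rp mp (r := fun w : k.-tuple X => (D w)%:E)) => //.
  by apply/measurable_EFinP; exact: measurable_Dz.
by apply: measurable_funB => //; exact: measurable_pinwt.
Qed.

Let mZp m k : measurable_fun setT (fun w : k.-tuple X => Zp w m).
Proof.
have h : measurable_fun setT (fun w : k.-tuple X => (Zp w m)%:E).
  under eq_fun do rewrite (Zp_E _ _).1.
  apply: (@measurable_pw_param _ _ _ (nuL mLam nuLam) _ _ _ (fun (w : k.-tuple X) (v : m.-tuple X) =>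
     (boltz (pin (psi w) w) v)%:E)); last first.
    by move=> w v; rewrite lee_fin; have /andP[] := boltz_itv v (rpin w).
  apply/measurable_EFinP.
  have m1 : seq_meas (fun p : k.-tuple X * m.-tuple X => tval p.1).
    exact: seq_meas_comp measurable_fst (tval_meas k).
  apply: (measurable_boltz_pin mdist sp rp mp (y := y)
    (r := fun p : k.-tuple X * m.-tuple X => (D p.1)%:E)) => //.
  - by move=> p; exact: rpw.
  - by apply/measurable_EFinP; exact: (measurable_Dz mdist m1).
  - exact: seq_meas_comp measurable_snd (tval_meas m).
exact/measurable_EFinP.
Qed.

Let mP k : cmeas (fun w : k.-tuple X => P w).
Proof.
apply: (@cmeas_cto _ _ _ (fun n (w : k.-tuple X) => \sum_(m < n) cf lam m * (Zp w m)%:C%C)).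
  move=> n; apply: (@cmeas_sum _ _ _ _ (fun m (w : k.-tuple X) => cf lam m * (Zp w m)%:C%C)) => m.
  by apply: cmeasM; [exact: cmeas_cst|apply: cmeas_real; exact: mZp].
by move=> w; apply: cto_csum; apply: (@ccvg_cf _ _ _ L0) => // m; exact: (Zp_E w m).2.
Qed.

Let mfD k : cmeas (fun w : k.-tuple X => f (D w)%:E).
Proof.
pose Zf (w : k.-tuple X) m := Zk nu Lam (ppin dist z phi y (D w)%:E) m.
have mZf m : measurable_fun setT (fun w => Zf w m).
  have h : measurable_fun setT (fun w : k.-tuple X => (Zf w m)%:E).
    under eq_fun do rewrite (Zt_E _ (DE0 _)).1.
    apply: (@measurable_pw_param _ _ _ (nuL mLam nuLam) _ _ _ (fun (w : k.-tuple X) (v : m.-tuple X) =>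
       (boltz (ppin dist z phi y (D w)%:E) v)%:E)); last first.
      by move=> w v; rewrite lee_fin; have /andP[] := boltz_itv v (rpw w).
    apply/measurable_EFinP.
    have m1 : seq_meas (fun p : k.-tuple X * m.-tuple X => tval p.1).
      exact: seq_meas_comp measurable_fst (tval_meas k).
    apply: (measurable_boltz_ppin y mdist sp rp mp
      (r := fun p : k.-tuple X * m.-tuple X => (D p.1)%:E)).
    - by apply/measurable_EFinP; exact: (measurable_Dz mdist m1).
    - exact: seq_meas_comp measurable_snd (tval_meas m).
  exact/measurable_EFinP.
apply: (@cmeas_cto _ _ _ (fun n w => \sum_(m < n) cf lam m * (Zf w m)%:C%C)).
  move=> n; apply: (@cmeas_sum _ _ _ _ (fun m w => cf lam m * (Zf w m)%:C%C)) => m.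
  by apply: cmeasM; [exact: cmeas_cst|apply: cmeas_real; exact: mZf].
move=> w; apply: cto_csum; apply: (@ccvg_cf _ _ _ L0) => // m.
exact: (Zt_E m (DE0 w)).2.
Qed.

Lemma ncP w : nc (P w) <= expR q.
Proof. by apply: nc_csum_cf => // m; exact: (Zp_E w m).2. Qed.

Lemma ncf t : (0 <= t)%E -> nc (f t) <= expR q.
Proof. by move=> t0; apply: nc_csum_cf => // m; exact: (Zt_E m t0).2. Qed.

(** * Expansion of the increments of [f] *)

Let A k s t := [set w : k.-tuple X | (s <= (D w)%:E < t)%E].

Lemma measurable_A k s t : measurable (@A k s t).
Proof.
have mD : measurable_fun setT (fun w : k.-tuple X => (D w)%:E).
  by apply/measurable_EFinP; exact: measurable_Dz.
have h : measurable_fun setT (fun w : k.-tuple X => (s <= (D w)%:E < t)%E).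
  apply: measurable_and.
    exact: (measurable_fun_lee (measurable_cst s) mD).
  exact: (measurable_fun_lte mD (measurable_cst t)).
by have := h measurableT [set true]; rewrite setTI; exact.
Qed.

Let ind k s t (w : k.-tuple X) : R := \1_(@A k s t) w.

Let ind_itv k s t (w : k.-tuple X) : 0 <= ind s t w <= 1.
Proof. by rewrite /ind indicE; case: (_ \in _); rewrite ?lexx ?ler01. Qed.

Let mind k s t : measurable_fun setT (fun w : k.-tuple X => ind s t w).
Proof. exact: measurable_indic (@measurable_A k s t). Qed.

Let U j m s t := cI (mu j) (fun w => (ind s t w * base w)%:C%C * (Zp w m)%:C%C).

(** [boltz_ppin_incr] integrated over k points, then sorted by the size j of the responsible
    subsequence through [split_integral]. *)
Lemma Zk_incr k s t : (0 <= s)%E -> (s <= t)%E ->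
  (Zk nu Lam (ppin dist z phi y s) k - Zk nu Lam (ppin dist z phi y t) k)%:C%C =
  \sum_(j < k.+1) 'C(k, j)%:R * U j (k - j) s t.
Proof.
move=> s0 st; have t0 := le_trans s0 st.
pose F w v := (incr_weight dist z phi y s t w v)%:E.
have mF : meas2 F.
  move=> d' T h1 h2 m1 m2; apply/measurable_EFinP.
  exact: (measurable_incr_weight mdist sp rp mp s t _ m1 m2).
have F0 w v : (0 <= F w v)%E.
  by rewrite lee_fin; have /andP[] := @incr_weight_itv _ _ _ dist z phi y rp s t w v (rpw w).
have e1 : (Zk nu Lam (ppin dist z phi y s) k)%:E =
    ((Zk nu Lam (ppin dist z phi y t) k)%:E +
    \int[mu k]_x (\sum_(p <- splits x) F p.1 p.2))%E.
  rewrite (Zt_E k s0).1 (Zt_E k t0).1.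
  have mb r : measurable_fun setT (fun w : k.-tuple X => (boltz (ppin dist z phi y r) w)%:E).
    apply/measurable_EFinP.
    exact: (measurable_boltz_ppin y mdist sp rp mp (r := fun=> r) (measurable_cst _) (tval_meas k)).
  have b0 r : (0 <= r)%E -> forall w : k.-tuple X,
      (0 <= (boltz (ppin dist z phi y r) w)%:E)%E.
    by move=> r0 w; rewrite lee_fin; have /andP[] := boltz_itv w (rpp r0).
  have ms : measurable_fun setT (fun x : k.-tuple X => \sum_(p <- splits x) F p.1 p.2)%E.
    exact: measurable_splits mF (tval_meas k).
  rewrite -ge0_integralD//; first last.
  - by move=> x _; exact: sume_ge0.
  - by move=> x _; exact: b0.
  apply: ge0_ae_eq_integral => //.
  - exact: emeasurable_funD.
  - by move=> x _; exact: b0.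
  - by move=> x _; apply: adde_ge0; [exact: b0|exact: sume_ge0].
  (* The pointwise identity needs distinct values of [D] on subsequences; the exceptional
     configurations are null by Assumption (A). *)
  have g0 := pw_generic mdist ac k.
  exists [set w : k.-tuple X | ~~ generic dist z w]; split => //.
    exact: measurable_generic_set.
  move=> x /= nx; apply/negP => gx; apply: nx => _.
  rewrite sumEFin -EFinD; congr EFin.
  by apply: boltz_ppin_incr => //; exact: generic_uniq.
(* For fixed [w] the inner integral over [v] is a coefficient of the partition function pinned at
   [w]. *)
have ZpF j m (w : j.-tuple X) : (\int[mu m]_v F w v)%E = (ind s t w * base w * Zp w m)%:E.
  rewrite EFinM (Zp_E w m).1 /F /incr_weight -/D /ind indicE.
  have [aw|aw] := boolP (s <= (D w)%:E < t)%E.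
    rewrite mem_set// mul1r; under eq_integral do rewrite EFinM.
    rewrite ge0_integralZl_EFin//.
    - by move=> v _; rewrite lee_fin; have /andP[] := boltz_itv v (rpin w).
    - apply/measurable_EFinP.
      apply: (measurable_boltz_pin mdist sp rp mp (r := fun=> (D w)%:E) (w := fun=> tval w)).
      + by move=> _; exact: rpw.
      + exact: measurable_cst.
      + exact: seq_meas_cst.
      + exact: tval_meas.
    - by have /andP[] := base_itv w.
  rewrite memNset ?mul0r ?mul0e ?integral0//; exact/negP.
have UE j m : (\int[mu j]_w \int[mu m]_v F w v)%E = (complex.Re (U j m s t))%:E /\
    complex.Im (U j m s t) = 0.
  split; last first.
    rewrite /U /cI /=; under eq_integral do rewrite mulr0 mul0r addr0.
    by rewrite integral0.
  under eq_integral do rewrite ZpF; rewrite /U /cI /=.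
  under [in RHS]eq_integral do rewrite mul0r subr0.
  rewrite fineK//; apply: (@integrable_fin_num _ _ _ _ setT) => //.
  apply: (@bounded_integrable _ _ _ (mu j) (fun w => ind s t w * base w * Zp w m) (L ^+ m)).
    exact: (measurable_funM (measurable_funM (mind s t) (@mbase j)) (@mZp m j)).
  move=> w; have /andP[z0 z1] := (Zp_E w m).2; have /andP[b0 b1] := base_itv w.
  have /andP[i0 i1] := ind_itv s t w.
  rewrite ger0_norm; last by apply: mulr_ge0 => //; apply: mulr_ge0.
  by apply: le_trans z1; rewrite ler_piMl// mulr_ile1.
have e2 : Zk nu Lam (ppin dist z phi y s) k - Zk nu Lam (ppin dist z phi y t) k =
    \sum_(j < k.+1) 'C(k, j)%:R * complex.Re (U j (k - j) s t).
  move: e1; rewrite split_integral//.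
  under eq_bigr do rewrite natmule -/(mu _) (UE _ _).1 -EFinM.
  by rewrite sumEFin -EFinD => -[->]; rewrite addrC addKr.
rewrite e2 rmorph_sum; apply: eq_bigr => j _.
rewrite rmorphM rmorph_nat; congr (_ * _).
by apply: ceqP; rewrite ?(UE _ _).2.
Qed.

Let Q j s t := cI (mu j) (fun w => (ind s t w * base w)%:C%C * (cf lam j * P w)).

Let ib_itv k s t (w : k.-tuple X) : 0 <= ind s t w * base w <= 1.
Proof.
have /andP[i0 i1] := ind_itv s t w; have /andP[b0 b1] := base_itv w.
by rewrite mulr_ge0//= mulr_ile1.
Qed.

Let nc_ib k s t (w : k.-tuple X) g : nc ((ind s t w * base w)%:C%C * g) <= nc g.
Proof.
have /andP[i0 i1] := ib_itv s t w.
by rewrite nc_realM// ler_piMl// nc_ge0.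
Qed.

Let cmeas_ib k s t (g : k.-tuple X -> R[i]) : cmeas g ->
  cmeas (fun w => (ind s t w * base w)%:C%C * g w).
Proof.
by move=> mg; apply: cmeasM => //; apply: cmeas_real; exact: measurable_funM (mind s t) (@mbase k).
Qed.

Let ccvg_Zt t : (0 <= t)%E ->
  ccvg_series (fun k => cf lam k * (Zk nu Lam (ppin dist z phi y t) k)%:C%C).
Proof. by move=> t0; apply: (@ccvg_cf _ _ _ L0) => m; exact: (Zt_E m t0).2. Qed.

(** Partial sums of f s - f t are Cauchy triangles [V], with the series in [v] cut at n - j.
    Completing that series to [P w] costs a sum of exponential tails, which [exp_tail_cvg] sends to
    0. *)
Lemma cto_incr s t : (0 <= s)%E -> (s <= t)%E ->
  cto (fun n => \sum_(j < n) Q j s t) (f s - f t).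
Proof.
move=> s0 st; have t0 := le_trans s0 st.
pose V j M := cI (mu j) (fun w => (ind s t w * base w)%:C%C *
  (cf lam j * \sum_(m < M) cf lam m * (Zp w m)%:C%C)).
have mS j M : cmeas (fun w : j.-tuple X => \sum_(m < M) cf lam m * (Zp w m)%:C%C).
  apply: (@cmeas_sum _ _ _ _ (fun m w => cf lam m * (Zp (tval w) m)%:C%C)) => m.
  by apply: cmeasM; [exact: cmeas_cst|apply: cmeas_real; exact: mZp].
have ncZ (w : seq X) m : nc (Zp w m)%:C%C <= L ^+ m.
  by have /andP[h0 h1] := (Zp_E w m).2; rewrite nc_real ger0_norm.
have VE j M : V j M = \sum_(m < M) cf lam j * cf lam m * U j m s t.
  have mU m : cmeas (fun w : j.-tuple X => (ind s t w * base w)%:C%C * (Zp w m)%:C%C).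
    by apply: cmeas_ib; apply: cmeas_real; exact: mZp.
  have bU m : cbounded (fun w : j.-tuple X => (ind s t w * base w)%:C%C * (Zp w m)%:C%C).
    by exists (L ^+ m) => w; apply: le_trans (nc_ib _ _ _ _) _.
  transitivity (cI (mu j) (fun w => \sum_(m < M)
      (cf lam j * cf lam m) * ((ind s t w * base w)%:C%C * (Zp w m)%:C%C))).
    congr cI; apply/funext => w; rewrite !mulr_sumr; apply: eq_bigr => m _; ring.
  rewrite (@cI_sum _ _ _ (mu j) M (fun m (w : j.-tuple X) => cf lam j * cf lam m *
      ((ind s t w * base w)%:C%C * (Zp w m)%:C%C))).
  - by apply: eq_bigr => m _; rewrite cIZ.
  - by move=> m; apply: cmeasM => //; exact: cmeas_cst.
  - move=> m; have [C bC] := bU m; exists (nc (cf lam j * cf lam m) * C) => w.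
    by apply: le_trans (ncM _ _) _; rewrite ler_wpM2l// nc_ge0.
have S1 : cto (fun n => \sum_(j < n) V j (n - j)%N) (f s - f t).
  have := ctoD (cto_csum (ccvg_Zt s0)) (ctoN (cto_csum (ccvg_Zt t0))).
  rewrite -!partitionE; congr cto; apply/funext => n.
  have eB (c : R[i]) (a b : R) : c * a%:C%C - c * b%:C%C = c * (a - b)%:C%C.
    by rewrite rmorphB mulrBr.
  rewrite -sumrB; under eq_bigr do rewrite eB Zk_incr//.
  under [RHS]eq_bigr do rewrite VE.
  rewrite -(triangle_sum (fun j m => cf lam j * cf lam m * U j m s t)).
  apply: eq_bigr => k _; rewrite mulr_sumr; apply: eq_bigr => j _.
  by rewrite mulrA cf_binom// -ltnS.
have S2 : cto (fun n => \sum_(j < n) V j (n - j)%N - \sum_(j < n) Q j s t) 0.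
  apply: (cto_squeeze (exp_tail_cvg q)) => n; rewrite subr0 -sumrB.
  apply: le_trans (nc_sum _ _) _; apply: ler_sum => j _.
  set M := (n - j)%N.
  have T0 (w : seq X) : nc (\sum_(m < M) cf lam m * (Zp w m)%:C%C - P w) <= exp_tail q M.
    by rewrite ncBC; apply: (@nc_csum_cf_tail _ lam L L0 (Zp w)) => m; exact: (Zp_E w m).2.
  have T1 : 0 <= exp_tail q M by exact: le_trans (nc_ge0 _) (T0 [::]).
  have bP : cbounded (fun w : j.-tuple X => (ind s t w * base w)%:C%C * (cf lam j * P w)).
    exists (nc (cf lam j) * expR q) => w; apply: le_trans (nc_ib _ _ _ _) _.
    by apply: le_trans (ncM _ _) _; rewrite ler_wpM2l ?nc_ge0// ncP.
  have mPj : cmeas (fun w : j.-tuple X => (ind s t w * base w)%:C%C * (cf lam j * P w)).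
    by apply: cmeas_ib; apply: cmeasM; [exact: cmeas_cst|exact: mP].
  have mVj : cmeas (fun w : j.-tuple X => (ind s t w * base w)%:C%C *
      (cf lam j * \sum_(m < M) cf lam m * (Zp w m)%:C%C)).
    by apply: cmeas_ib; apply: cmeasM; [exact: cmeas_cst|exact: mS].
  have bV : cbounded (fun w : j.-tuple X => (ind s t w * base w)%:C%C *
      (cf lam j * \sum_(m < M) cf lam m * (Zp w m)%:C%C)).
    exists (nc (cf lam j) * (exp_tail q M + expR q)) => w; apply: le_trans (nc_ib _ _ _ _) _.
    apply: le_trans (ncM _ _) _; rewrite ler_wpM2l ?nc_ge0//.
    rewrite -[X in nc X](subrK (P w)); apply: le_trans (ncD _ _) _.
    by apply: lerD; [exact: T0|exact: ncP].
  have -> : V j M - Q j s t = cI (mu j) (fun w => (ind s t w * base w)%:C%C *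
      (cf lam j * (\sum_(m < M) cf lam m * (Zp w m)%:C%C - P w))).
    rewrite -mulN1r -(cIZ _ _ mPj bP) -cID; [|exact: mVj|exact: bV| |]; last 2 first.
    - by apply: cmeasM; [exact: cmeas_cst|exact: mPj].
    - by have [C bC] := bP; exists C => w; rewrite mulN1r ncN.
    congr cI; apply/funext => w; ring.
  apply: (@le_trans _ _ (nc (cf lam j) * exp_tail q M * fine (mu j setT))).
    apply: nc_cI; [|exact: measurableT| |].
    - apply: cmeas_ib; apply: cmeasM; first exact: cmeas_cst.
      have -> : (fun w : j.-tuple X => \sum_(m < M) cf lam m * (Zp w m)%:C%C - P w) =
          (fun w => \sum_(m < M) cf lam m * (Zp (tval w) m)%:C%C + (- 1) * P w).
        by apply/funext => w; rewrite mulN1r.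
      by apply: cmeasD => //; apply: cmeasM; [exact: cmeas_cst|exact: mP].
    - by rewrite mulr_ge0// nc_ge0.
    - move=> w; rewrite indicT mulr1; apply: le_trans (nc_ib _ _ _ _) _.
      by apply: le_trans (ncM _ _) _; rewrite ler_wpM2l ?nc_ge0.
  rewrite muT /= mulrAC ler_wpM2r//; exact: nc_cfL.
have := ctoD S1 (ctoN S2); rewrite oppr0 addr0; congr cto.
by apply/funext => n; rewrite opprB addrCA subrr addr0.
Qed.

(** * The dominating measure [rho] *)

Let Bd k := nc (cf lam k.+1) * expR q.

Let Bd_ge0 k : 0 <= Bd k.
Proof. by rewrite /Bd mulr_ge0 ?nc_ge0// expR_ge0. Qed.

Let mDt k : measurable_fun setT (fun w : k.-tuple X => D w).
Proof. exact: (measurable_Dz mdist (@tval_meas k)). Qed.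

Let push k : {measure set R -> \bar R} :=
  measure_function_pushforward__canonical__measure_function_Measure (mu k.+1) (@mDt k.+1).

(** Layer k is the image under [D] of the measure on k+1 points, weighted by the bound [Bd k] for
    lam^(k+1) / (k+1)! * P w. The layers start at one point: the empty configuration has D = 0 and
    would create an atom. *)
Let rho : {measure set R -> \bar R} :=
  mseries (fun k => mscale (NngNum (Bd_ge0 k)) (push k)) 0.

Let rho_part (S : set R) n := \sum_(k < n) Bd k * fine (mu k.+1 ((fun w : k.+1.-tuple X => D w) @^-1` S)).

Let mpre k (S : set R) : measurable S ->
  measurable ((fun w : k.-tuple X => D w) @^-1` S).
Proof. by move=> mS; rewrite -[X in measurable X]setTI; exact: mDt. Qed.

Let mu_fin k (S : set (k.-tuple X)) : measurable S -> mu k S \is a fin_num.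
Proof. by move=> mS; exact: fin_num_measure. Qed.

Let rhoE S : measurable S ->
  rho S = limn (fun n => (rho_part S n)%:E).
Proof.
move=> mS; rewrite /rho /= /mseries; congr (limn _); apply/funext => n.
rewrite /rho_part -sumEFin big_mkord; apply: eq_bigr => k _.
by rewrite /mscale /= EFinM fineK//; apply: mu_fin; exact: mpre.
Qed.

Let rho_part_nd S : {homo rho_part S : n m / (n <= m)%N >-> n <= m}.
Proof.
move=> n m nm; rewrite /rho_part -!(big_mkord xpredT (fun k =>
  Bd k * fine (mu k.+1 ((fun w : k.+1.-tuple X => D w) @^-1` S)))).
rewrite (big_cat_nat (leq0n n) nm) /= lerDl; apply: sumr_ge0 => k _.
by rewrite mulr_ge0// fine_ge0.
Qed.

(** One factor expR q bounds [P]; the other bounds the exponential series in q without its constant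
    term. *)
Let rho_part_le S n : measurable S -> rho_part S n <= expR q * expR q.
Proof.
move=> mS; apply: (@le_trans _ _ (\sum_(k < n) expR q * exp_coeff q k.+1)).
  apply: ler_sum => k _; rewrite /Bd mulrAC mulrC ler_wpM2l ?expR_ge0//.
  apply: le_trans (nc_cfL lam L0 k.+1); rewrite ler_wpM2l ?nc_ge0//.
  rewrite -lee_fin -muT fineK; last by apply: mu_fin; exact: mpre.
  by apply: le_measure; rewrite ?inE//; apply/mem_set => //; exact: mpre.
rewrite -mulr_sumr ler_wpM2l ?expR_ge0//.
have q0 : 0 <= q by rewrite mulr_ge0 ?nc_ge0.
apply: (@le_trans _ _ (series (exp_coeff q) n.+1)).
  rewrite /series /= big_mkord [leRHS]big_ord_recl /= lerDr /exp_coeff /=.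
  by rewrite expr0 fact0 divr1.
apply: (@nondecreasing_cvgn_le _ (series (exp_coeff q))).
  apply/nondecreasing_seqP => m; rewrite /series /= big_nat_recr//= lerDl.
  by rewrite /exp_coeff /= divr_ge0// exprn_ge0.
exact: is_cvg_series_exp_coeff.
Qed.

Let rho_part_cvg S : measurable S ->
  (rho S \is a fin_num) /\ (rho_part S n @[n --> \oo] --> fine (rho S)).
Proof.
move=> mS.
have c : cvgn (rho_part S).
  apply: nondecreasing_is_cvgn; first exact: rho_part_nd.
  by exists (expR q * expR q) => _ [n _ <-]; exact: rho_part_le.
have -> : rho S = (limn (rho_part S))%:E.
  by rewrite rhoE// -EFin_lim.
by split.
Qed.

Let mc t := distr rho t.

Let rho_fin S : measurable S -> rho S \is a fin_num.
Proof. by move=> mS; exact: (rho_part_cvg mS).1. Qed.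

Let mc_itv t : 0 <= mc t <= expR q * expR q.
Proof.
rewrite /mc /distr fine_ge0//=; have [_ h] := rho_part_cvg (mbelow t).
by apply: (ler_cvg_to h (cvg_cst _)); apply: nearW => n; apply: rho_part_le; exact: mbelow.
Qed.

Let mc_le s t : (s <= t)%E -> mc s <= mc t.
Proof. exact: distr_le. Qed.

Let muA k s t : (s <= t)%E -> fine (mu k (@A k s t)) =
  fine (mu k ((fun w : k.-tuple X => D w) @^-1` below t)) -
  fine (mu k ((fun w : k.-tuple X => D w) @^-1` below s)).
Proof.
move=> st; set Dt := _ @^-1` below t; set Ds := _ @^-1` below s.
have mt : measurable Dt by apply: mpre; exact: mbelow.
have ms : measurable Ds by apply: mpre; exact: mbelow.
have -> : Dt = @A k s t `|` Ds.
  apply/seteqP; split => w /=; rewrite /A /Ds /Dt /below /=.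
    by move=> wt; case: (ltP (D w)%:E s) => ws; [right|left; rewrite wt].
  by case=> [/andP[]//|/lt_le_trans]; exact.
rewrite measureU//; last 2 first.
- exact: measurable_A.
- apply/seteqP; split => // w [] /=; rewrite /A /Ds /below /= => /andP[sw _].
  by rewrite ltNge sw.
rewrite fineD ?addrK//; apply: mu_fin => //; exact: measurable_A.
Qed.

(** One majorant argument for three estimates: C is 1 for increments of [f], 2 / delta for [M], and
    2 / delta times the mass of [s, t) for the first-order defect. *)
Lemma csum_le_mc (u : nat -> R[i]) C s t : 0 <= C -> (s <= t)%E ->
  (forall k, nc (u k) <= C * (Bd k * fine (mu k.+1 (@A k.+1 s t)))) ->
  ccvg_series u /\ nc (csum u) <= C * (mc t - mc s).
Proof.
move=> C0 st h.
pose b k := C * (Bd k * fine (mu k.+1 (@A k.+1 s t))).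
have cb : series b @ \oo --> C * (mc t - mc s).
  have -> : series b = fun n => C * (rho_part (below t) n - rho_part (below s) n).
    apply/funext => n; rewrite /series /= big_mkord -mulr_sumr /rho_part -sumrB.
    by congr (_ * _); apply: eq_bigr => k _; rewrite -mulrBr -muA.
  by apply: cvgMr; apply: cvgB; [exact: (rho_part_cvg (mbelow t)).2
                                |exact: (rho_part_cvg (mbelow s)).2].
have cvb : cvgn (series b) by apply/cvg_ex; eexists; exact: cb.
split; first exact: ccvg_majorant h cvb.
by rewrite -(cvg_lim (@Rhausdorff R) cb); exact: nc_csum.
Qed.

(** * The exponent [M] and the first-order estimate *)

(** This is [main_integrand] divided by (k+1)!, arranged so that multiplying by f(D w) restores the
    integrand of [Q]. *)
Let G k (w : k.+1.-tuple X) :=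
  (base w)%:C%C * (cf lam k.+1 * P w) * (f (D w)%:E)^-1.
Let Mj k s t := cI (mu k.+1) (fun w => (ind s t w)%:C%C * G w).
Let M s t := csum (fun k => Mj k s t).

Let f_neq0 t : (0 <= t)%E -> f t != 0.
Proof. by move=> t0; exact: norm_ge_neq0 delta0 (zf t0). Qed.

Let mG k : cmeas (@G k).
Proof.
apply: cmeasM.
  apply: cmeasM; first by apply: cmeas_real; exact: mbase.
  by apply: cmeasM; [exact: cmeas_cst|exact: mP].
by apply: cmeas_inv; [exact: mfD|move=> w; exact: f_neq0].
Qed.

Let nc_basePG k (w : k.+1.-tuple X) : nc ((base w)%:C%C * (cf lam k.+1 * P w)) <= Bd k.
Proof.
have /andP[b0 b1] := base_itv w; rewrite nc_realM//.
apply: (@le_trans _ _ (1 * (nc (cf lam k.+1) * expR q))); last by rewrite mul1r.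
rewrite ler_pM ?nc_ge0//; apply: le_trans (ncM _ _) _.
by rewrite ler_wpM2l ?nc_ge0// ncP.
Qed.

Let nc_G k (w : k.+1.-tuple X) : nc (G w) <= Bd k * (2 / delta).
Proof.
apply: le_trans (ncM _ _) _; rewrite ler_pM ?nc_ge0//.
by apply: nc_inv => //; exact: zf.
Qed.

Let mind_G k s t : cmeas (fun w : k.+1.-tuple X => (ind s t w)%:C%C * G w).
Proof. by apply: cmeasM; [apply: cmeas_real; exact: mind|exact: mG]. Qed.

Let bind_G k s t : cbounded (fun w : k.+1.-tuple X => (ind s t w)%:C%C * G w).
Proof.
exists (Bd k * (2 / delta)) => w; have /andP[i0 i1] := ind_itv s t w.
rewrite nc_realM//; apply: le_trans (nc_G w).
by rewrite ler_piMl// nc_ge0.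
Qed.

Let d2 : 0 <= 2 / delta. Proof. by rewrite divr_ge0// ltW. Qed.

Let f_incr s t : (0 <= s)%E -> (s <= t)%E ->
  ccvg_series (fun k => Q k.+1 s t) /\ csum (fun k => Q k.+1 s t) = f s - f t.
Proof.
move=> s0 st; apply: csumP.
(* The empty subsequence is never responsible for a change, so the sum starts at one point. *)
have Q0 : Q 0 s t = 0.
  rewrite /Q; have -> : (fun w : 0.-tuple X => (ind s t w * base w)%:C%C * (cf lam 0 * P w)) = fun=> 0.
    by apply/funext => w; rewrite (tuple0 w) /base /pinwt /= subrr mul0r mulr0 mul0r.
  by apply: ceqP; rewrite /cI /= integral0.
have [hr hi] := cto_incr s0 st.
have e n : \sum_(k < n) Q k.+1 s t = \sum_(k < n.+1) Q k s t.
  by rewrite big_ord_recl Q0 add0r.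
by split; under eq_fun do rewrite e;
  [rewrite -cvg_shiftS in hr|rewrite -cvg_shiftS in hi].
Qed.

Lemma nc_f_incr s t : (0 <= s)%E -> (s <= t)%E -> nc (f s - f t) <= mc t - mc s.
Proof.
move=> s0 st; have [_ <-] := f_incr s0 st; rewrite -[leRHS]mul1r.
apply: (@csum_le_mc _ _ _ _ _ st _).2 => // k; rewrite mul1r.
apply: nc_cI.
- by apply: cmeas_ib; apply: cmeasM; [exact: cmeas_cst|exact: mP].
- exact: measurable_A.
- exact: Bd_ge0.
move=> w; have /andP[i0 i1] := ind_itv s t w.
rewrite rmorphM -mulrA nc_realM// mulrC ler_wpM2r//; exact: nc_basePG.
Qed.

Let M_bound s t : (s <= t)%E -> ccvg_series (fun k => Mj k s t) /\
  nc (M s t) <= (2 / delta) * (mc t - mc s).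
Proof.
move=> st; apply: csum_le_mc => // k; rewrite mulrCA mulrA.
apply: nc_cI; [exact: mind_G|exact: measurable_A|exact: mulr_ge0 (Bd_ge0 k) d2|].
move=> w; have /andP[i0 i1] := ind_itv s t w.
rewrite nc_realM// mulrC ler_wpM2r//; exact: nc_G.
Qed.

(** The defect is the series of [M] with the extra factor f(D w) - f s. On s <= D w < t that factor
    is at most the mass of [s, D w), hence of [s, t), and the integral supplies the second power. *)
Lemma nc_f_first_order s t : (0 <= s)%E -> (s <= t)%E ->
  nc (f s - f t - f s * M s t) <= (2 / delta) * (mc t - mc s) ^+ 2.
Proof.
move=> s0 st; have [cQ <-] := f_incr s0 st; have [cM _] := M_bound st.
pose v k := cI (mu k.+1) (fun w => (ind s t w)%:C%C * (G w * (f (D w)%:E - f s))).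
have vE k : v k = Q k.+1 s t - f s * Mj k s t.
  have mfG : cmeas (fun w : k.+1.-tuple X => f s * ((ind s t w)%:C%C * G w)).
    apply: cmeasM; [exact: cmeas_cst|exact: mind_G].
  have bfG : cbounded (fun w : k.+1.-tuple X => f s * ((ind s t w)%:C%C * G w)).
    have [C bC] := @bind_G k s t; exists (nc (f s) * C) => w.
    by apply: le_trans (ncM _ _) _; rewrite ler_wpM2l ?nc_ge0.
  rewrite /Mj -(cIZ _ _ (@mind_G k s t) (@bind_G k s t)) -mulN1r -(cIZ _ _ mfG bfG).
  rewrite /Q -cID.
  - congr cI; apply/funext => w; rewrite /G.
    have -> : (ind s t w * base w)%:C%C = (ind s t w)%:C%C * (base w)%:C%C by rewrite rmorphM.
    by have := f_neq0 (DE0 w); set F := f (D w)%:E => F0; field.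
  - by apply: cmeas_ib; apply: cmeasM; [exact: cmeas_cst|exact: mP].
  - exists (nc (cf lam k.+1) * expR q) => w; apply: le_trans (nc_ib _ _ _ _) _.
    by apply: le_trans (ncM _ _) _; rewrite ler_wpM2l ?nc_ge0// ncP.
  - by apply: cmeasM; [exact: cmeas_cst|exact: mfG].
  - by have [C bC] := bfG; exists C => w; rewrite mulN1r ncN.
have [_ e] : ccvg_series v /\ csum v = csum (fun k => Q k.+1 s t) - f s * M s t.
  apply: csumP; have := ctoD (cto_csum cQ) (ctoN (ctoM (f s) (cto_csum cM))).
  congr cto; apply/funext => n; rewrite mulr_sumr -sumrB.
  by apply: eq_bigr => k _; rewrite vE.
rewrite -e expr2 mulrA; apply: (@csum_le_mc _ _ _ _ _ st _).2.
  by rewrite mulr_ge0// subr_ge0 mc_le.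
move=> k; rewrite mulrA; apply: nc_cI.
- apply: cmeasM; first by apply: cmeas_real; exact: mind.
  apply: cmeasM; first exact: mG.
  by apply: cmeasD; [exact: mfD|exact: cmeas_cst].
- exact: measurable_A.
- by apply: mulr_ge0 => //; apply: mulr_ge0 => //; rewrite subr_ge0 mc_le.
move=> w; rewrite /ind indicE; case: (boolP (w \in @A k.+1 s t)) => wA; last first.
  by rewrite mulr0 mul0r nc0.
move: wA => /set_mem /= /andP[sD Dt].
rewrite mul1r mulr1 [leRHS]mulrC mulrA; apply: le_trans (ncM _ _) _.
apply: ler_pM; [exact: nc_ge0|exact: nc_ge0|exact: nc_G|].
rewrite ncBC; apply: le_trans (nc_f_incr s0 sD) _.
by rewrite lerD2r mc_le// ltW.
Qed.

Let ind_add k s t (w : k.-tuple X) : (0 <= s)%E -> (s <= t)%E ->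
  ind 0%E t w = ind 0%E s w + ind s t w.
Proof.
move=> s0 st; rewrite /ind !indicE.
have inA a b : (w \in @A k a b) = (a <= (D w)%:E < b)%E.
  by apply/idP/idP => [/set_mem //|h]; exact/mem_set.
rewrite !inA !DE0 /=; case: (ltP (D w)%:E s) => Ds /=.
  by rewrite (lt_le_trans Ds st) addr0.
by rewrite add0r.
Qed.

Let M_add s t : (0 <= s)%E -> (s <= t)%E -> M 0%E t = M 0%E s + M s t.
Proof.
move=> s0 st; have [c1 _] := M_bound s0; have [c2 _] := M_bound st.
suff [] : ccvg_series (fun k => Mj k 0%E t) /\
  csum (fun k => Mj k 0%E t) = M 0%E s + M s t by [].
apply: csumP; have := ctoD (cto_csum c1) (cto_csum c2).
congr cto; apply/funext => n; rewrite -big_split /=; apply: eq_bigr => k _.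
rewrite /Mj -cID; [|exact: mind_G|exact: bind_G|exact: mind_G|exact: bind_G].
congr cI; apply/funext => w.
by rewrite (ind_add _ s0 st) rmorphD mulrDl.
Qed.

(** [K] bounds every [M a b]: it is 2 / delta times the bound on the total mass of [rho]. [Cst] is
    the constant of [nc_cexp_step] with E = expR q and c = 2 / delta. *)
Let K := 2 / delta * (expR q * expR q).
Let Cst := 2 * expR K * (expR q * (4 * expR K * (2 / delta) ^+ 2) + 2 / delta + 2 / delta).
Let h t := f t * cexp (M 0%E t).

Lemma nc_h_incr s t : (0 <= s)%E -> (s <= t)%E ->
  nc (h t - h s) <= Cst * (mc t - mc s) ^+ 2.
Proof.
move=> s0 st; have t0 := le_trans s0 st.
have [_ Mst] := M_bound st.
have D0 : 0 <= mc t - mc s by rewrite subr_ge0 mc_le.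
have MK a b : (a <= b)%E -> nc (M a b) <= K.
  move=> ab; apply: le_trans (M_bound ab).2 _; apply: ler_wpM2l; first exact: d2.
  have /andP[ma0 _] := mc_itv a; have /andP[_ mb1] := mc_itv b.
  by apply: le_trans mb1; rewrite gerBl.
rewrite /h (M_add s0 st); apply: nc_cexp_step.
- exact: d2.
- exact: D0.
- exact: expR_ge0.
- exact: ncf.
- exact: Mst.
- exact: MK.
- exact: MK.
- exact: nc_f_incr.
- exact: nc_f_first_order.
Qed.

Let rho_atom c : rho [set c] = 0%E.
Proof.
have [fi] := rho_part_cvg (measurable_set1 c).
have -> : rho_part [set c] = fun=> 0.
  apply/funext => n; rewrite /rho_part big1// => k _.
  have e0 : mu k.+1 ((fun w : k.+1.-tuple X => D w) @^-1` [set c]) = 0%E.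
    exact: (pw_Dz_eq mdist ac k c).
  by rewrite e0 /= mulr0.
move=> h0; rewrite -(fineK fi); congr EFin.
by rewrite -(cvg_lim (@Rhausdorff R) h0); exact: lim_cst.
Qed.

(** [quadratic_constant] covers finite thresholds only. The last step, from n to +oo, costs the
    square of the mass of [n, +oo), which tends to 0. *)
Lemma h_pinfty : h +oo%E = h 0%E.
Proof.
have Cst0 : 0 <= Cst.
  have e0 r : 0 <= expR r :> R by exact: expR_ge0.
  have c0 := exprn_ge0 2 d2.
  apply: mulr_ge0; first exact: mulr_ge0 (ler0n _ 2) (e0 K).
  apply: addr_ge0; last exact: d2.
  apply: addr_ge0; last exact: d2.
  apply: mulr_ge0; first exact: e0.
  exact: mulr_ge0 (mulr_ge0 (ler0n _ 4) (e0 K)) c0.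
have hR r : 0 <= r -> h r%:E = h 0%E.
  apply: (@quadratic_constant R (fun r => mc r%:E) (fun r => h r%:E) Cst) .
  - exact: (distr_continuous rho_fin rho_atom).
  - exact: Cst0.
  - by move=> a b ab; apply: mc_le; rewrite lee_fin.
  - by move=> a b a0 ab; apply: nc_h_incr; rewrite lee_fin.
apply/eqP; rewrite -subr_eq0; apply/eqP/nc_eq0.
have c1 : mc +oo%E - mc (n%:R)%:E @[n --> \oo] --> (0 : R).
  rewrite -(subrr (mc +oo%E)).
  by apply: cvgB; [exact: cvg_cst|exact: (distr_cvg_pinfty rho_fin)].
have c0 : Cst * (mc +oo%E - mc (n%:R)%:E) ^+ 2 @[n --> \oo] --> (0 : R).
  rewrite [X in _ --> X](_ : 0 = Cst * (0 * 0)); last by rewrite !mulr0.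
  by under eq_fun do rewrite expr2; apply: cvgMr; exact: cvgM.
apply: (ler_cvg_to (cvg_cst _) c0); apply: nearW => n.
rewrite -(hR n%:R)//; apply: nc_h_incr; first by rewrite lee_fin.
exact: leey.
Qed.

(** * Identification with the terms of the theorem *)

Let G_main k (w : k.+1.-tuple X) : main_integrand dist z nu Lam phi lam y w =
  (k.+1)`!%:R * G w.
Proof.
rewrite /main_integrand /G /base /kappa expeR_hamiltonian; last exact: rpw.
rewrite size_tuple /cf /pinwt /wt /=.
have -> : nilp w = false by case/tupleP: w.
rewrite -/(psi w) -/(P w) -[Defs.partition _ _ (psi w) _]/(f (D w)%:E).
have n0 : (k.+1)`!%:R != 0 :> R[i] by rewrite pnatr_eq0 -lt0n fact_gt0.
by have := f_neq0 (DE0 w); set F := f _ => F0; field; rewrite F0 n0.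
Qed.

Let cmeas_main k : cmeas (fun w : k.+1.-tuple X => main_integrand dist z nu Lam phi lam y w).
Proof.
under eq_fun do rewrite G_main.
by apply: cmeasM; [exact: cmeas_cst|exact: mG].
Qed.

Let cbounded_main k :
  cbounded (fun w : k.+1.-tuple X => main_integrand dist z nu Lam phi lam y w).
Proof.
exists (nc (k.+1)`!%:R * (Bd k * (2 / delta))) => w; rewrite G_main.
by apply: le_trans (ncM _ _) _; rewrite ler_wpM2l ?nc_ge0.
Qed.

Let T (k : nat) := (((k.+1)`!)%:R)^-1 *
  cint nu Lam (main_integrand dist z nu Lam phi lam y (k := k.+1)).

Let T_Mj k : T k = Mj k 0%E +oo%E.
Proof.
have [mr mi] := @cmeas_main k.
rewrite /T /cint !integral_prodm; [|exact/measurable_EFinP|exact/measurable_EFinP].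
rewrite -[Complex _ _]/(cI (mu k.+1) (fun w => main_integrand dist z nu Lam phi lam y w)).
rewrite -cIZ//; congr cI; apply/funext => w; rewrite G_main mulKf; last first.
  by rewrite pnatr_eq0 -lt0n fact_gt0.
rewrite /ind indicE mem_set; first by rewrite mul1r.
by rewrite /A /= DE0 ltry.
Qed.

Lemma gas_cintegrable k :
  cintegrable nu Lam (main_integrand dist z nu Lam phi lam y (k := k.+1)).
Proof.
have [mr mi] := @cmeas_main k.
have [/integrableP[_ ir] /integrableP[_ ii]] :=
  cbounded_integrable (mu k.+1) (@cmeas_main k) (@cbounded_main k).
split; apply/integrableP; split.
- by apply: measurable_funTS; exact/measurable_EFinP.
- rewrite (integral_prodm mLam nuLam); first exact: ir.
  by apply: measurableT_comp => //; exact/measurable_EFinP.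
- by apply: measurable_funTS; exact/measurable_EFinP.
- rewrite (integral_prodm mLam nuLam); first exact: ii.
  by apply: measurableT_comp => //; exact/measurable_EFinP.
Qed.

Lemma gas_kappa : ccvg_series T /\ kappa nu Lam phi lam [:: y] = lam * cexp (- csum T).
Proof.
have -> : T = fun k => Mj k 0%E +oo%E by apply/funext => k; exact: T_Mj.
split; first exact: (M_bound (leey 0%E)).1.
rewrite -/(M 0%E +oo%E).
(* The endpoints of the interpolation: no value of [D] is below 0, and every value is below +oo. *)
have e0 : ppin dist z phi y 0%E = phi.
  by apply/funext => s; rewrite /ppin ltNge DE0.
have ey : ppin dist z phi y +oo%E = pin phi [:: y].
  by apply/funext => s; rewrite /ppin ltry.
have M00 : M 0%E 0%E = 0.
  apply: nc_eq0; apply: le_trans (M_bound (lexx 0%E)).2 _.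
  by rewrite subrr mulr0.
have e : f +oo%E * cexp (M 0%E +oo%E) = f 0%E * cexp 0.
  by rewrite -M00; exact: h_pinfty.
rewrite /kappa -ey -{2}e0; exact: cexp_quotient (f_neq0 (lexx 0%E)) e.
Qed.

End Gas.

Theorem mainTheorem7 (R : realType) (d : measure_display) (X : measurableType d)
    (dist : X -> X -> R) (nu : {measure set X -> \bar R}) (z : X)
    (Lam : set X) (lam : R[i]) (Phi : set (@potential R d X))
    (delta : R) :
  is_metric dist -> metric_complete dist -> metric_separable dist ->
  borel_for dist -> locally_finite dist nu -> assumptionA dist nu ->
  metric_bounded dist Lam -> measurable Lam ->
  (forall phi, Phi phi -> [/\ pot_symmetric phi, pot_repulsive phi & pot_measurable phi]) ->
  closed_under_modification dist z Phi ->
  0 < delta -> zero_free nu Lam lam delta Phi ->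
  forall phi (y : X), Phi phi ->
    let T := fun k : nat =>
      (((k.+1)`!)%:R)^-1 *
        cint nu Lam (main_integrand dist z nu Lam phi lam y (k := k.+1)) in
    (forall k : nat, cintegrable nu Lam (main_integrand dist z nu Lam phi lam y (k := k.+1))) /\
    ccvg_series T /\
    kappa nu Lam phi lam [:: y] = lam * cexp (- csum T).
Proof.
move=> dm _ _ bd lf aA bL mLam good [cl _] delta0 zf phi y Pphi T.
have d0 : forall a b, 0 <= dist a b by case: dm.
have md := dist_measurable z dm bd.
have nuLam : (nu Lam < +oo)%E by exact: lf.
(* Assumption (A) at the single centre [z] passes to the restricted measure by monotonicity. *)
have ac (A : set R) : measurable A -> (lebesgue_measure A = 0)%E ->
    nuL mLam nuLam (dist z @^-1` A) = 0%E.
  move=> mA A0; rewrite nuLE.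
  have mp : measurable (dist z @^-1` A) by rewrite -[X in measurable X]setTI; exact: md.
  apply: (@subset_measure0 _ _ _ nu _ (dist z @^-1` A)) => //; last exact: aA.
  exact: measurableI.
have [sp rp mp] := good _ Pphi.
(* The whole interpolating family stays in [Phi], so symmetry, repulsion and the bound delta hold
   uniformly in t. *)
have Pt t : (0 <= t)%E -> Phi (ppin dist z phi y t) by exact: cl.
have spp t : (0 <= t)%E -> pot_symmetric (ppin dist z phi y t).
  by move=> /Pt /good[].
have rpp t : (0 <= t)%E -> pot_repulsive (ppin dist z phi y t).
  by move=> /Pt /good[].
have zft t : (0 <= t)%E -> delta%:C%C <= `|Defs.partition nu Lam (ppin dist z phi y t) lam|.
  by move=> /Pt; exact: zf.
split; first exact: (gas_cintegrable d0 md mLam nuLam sp rp mp rpp delta0 zft).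
exact: (gas_kappa d0 md ac sp rp mp spp rpp delta0 zft).
Qed.
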